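(* Let $\mathcal{H}$ be an essential non-central hyperplane arrangement in $\mathbb{R}^n$ with intersection lattice $\mathcal{L}$, and let $Q$ be its poset of unbounded regions. Then $$\Psi(Q)=\varphi_{ub}\bigl(\Psi(\mathcal{L}\cup\{\hat0\})\bigr).$$
   Context: Essential: normals span $\mathbb{R}^n$; non-central: the intersection of all hyperplanes is empty. $\mathcal{L}$: all nonempty intersections of subsets of hyperplanes (empty intersection $=\mathbb{R}^n$) plus $\emptyset$ as maximum, ordered by reverse inclusion; $\mathcal{L}\cup\{\hat0\}$ has a new minimum, ranks $\rho(\hat0)=0$, $\rho(x)=n-\dim x+1$, $\rho(\emptyset)=n+2$. Faces of $\mathcal{H}$: nonempty relatively open cells of the decomposition of $\mathbb{R}^n$. $T$: faces plus an empty face (minimum) and a maximum, ordered by $F\le G$ iff $F\subseteq\bar G$; $T^*$ its dual, with the minimum of rank $0$, an $i$-dimensional face of rank $n+1-i$, the empty face of rank $n+2$. $Q$: the minimum of $T^*$ and all unbounded faces, plus an adjoined maximum of rank $n+2$, with $T^*$-ranks. $\mathbf{ab}$-index: for a poset $P$ with $\hat0,\hat1$ and rank function with $\rho(\hat0)=0$, $\rho(\hat1)=N+1$, $f_S$ ($S=\{s_1<\dots<s_{k-1}\}\subseteq\{1,\dots,N\}$) counts chains $\hat0<x_1<\dots<x_{k-1}<\hat1$ with $\rho(x_j)=s_j$, $h_S=\sum_{T\subseteq S}(-1)^{|S-T|}f_T$, $\Psi(P)=\sum_Sh_Su_S$, $u_S=u_1\cdots u_N$ with $u_i=\mathbf b$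 if $i\in S$, else $\mathbf a$. Coproduct: for a monomial $u=u_1\cdots u_N$, $\Delta^{k-1}(u)=\sum_{1\le i_1<\dots<i_{k-1}\le N}u_{(1)}\otimes\cdots\otimes u_{(k)}$, the $u_{(j)}$ being the consecutive segments obtained by deleting letters at positions $i_1,\dots,i_{k-1}$; written $\sum_u$. Linear maps on monomials: $\kappa(v)=(\mathbf a-\mathbf b)^m$ if $v=\mathbf a^m$, else $0$; $\beta(v)=(\mathbf a-\mathbf b)^m$ if $v=\mathbf b^m$, else $0$; $\eta(v)=2(\mathbf a-\mathbf b)^{m+k}$ if $v=\mathbf b^m\mathbf a^k$, else $0$; $\lambda_{ub}=\eta-2\beta$. $\varphi_{ub,1}=\kappa$, $\varphi_{ub,k}(v)=\sum_v\kappa(v_{(1)})\,\mathbf b\,\eta(v_{(2)})\,\mathbf b\cdots\mathbf b\,\eta(v_{(k-1)})\,\mathbf b\,\lambda_{ub}(v_{(k)})$ for $k\ge2$, and $\varphi_{ub}=\sum_{k\ge1}\varphi_{ub,k}$. *)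

(* Defs.v *)
From HB Require Import structures.
From mathcomp Require Import all_boot all_order all_algebra.
From mathcomp Require Import all_classical all_reals all_analysis.
(* Notations of monalg are incompatible with those of analysis. *)
From mathcomp.multinomials Require Import -(notations) monalg.

Set Implicit Arguments.
Unset Strict Implicit.
Unset Printing Implicit Defensive.

Import Order.TTheory GRing.Theory Num.Theory.
Import numFieldNormedType.Exports.

Local Open Scope ring_scope.
Local Open Scope classical_set_scope.

Inductive with_bounds (P : Type) := Bot | Elt of P | Top.
Arguments Bot {P}.
Arguments Elt {P} _.
Arguments Top {P}.

Section WithBounds.
Variable P : Type.

Definition wb_code (x : with_bounds P) : option (option P) :=
  match x with Bot => None | Top => Some None | Elt a => Some (Some a) end.

Definition wb_decode (x : option (option P)) : with_bounds P :=
  match x with None => Bot | Some None => Top | Some (Some a) => Elt a end.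

Lemma wb_codeK : cancel wb_code wb_decode. Proof. by case. Qed.

End WithBounds.

HB.instance Definition _ (P : eqType) :=
  Equality.copy (with_bounds P) (can_type (@wb_codeK P)).
HB.instance Definition _ (P : choiceType) :=
  Choice.copy (with_bounds P) (can_type (@wb_codeK P)).
HB.instance Definition _ (P : countType) :=
  Countable.copy (with_bounds P) (can_type (@wb_codeK P)).
HB.instance Definition _ (P : finType) :=
  Finite.copy (with_bounds P) (can_type (@wb_codeK P)).

Section WithBoundsOrder.
Variables (d : Order.disp_t) (P : porderType d).

Definition wb_le (x y : with_bounds P) : bool :=
  match x, y with
  | Bot, _ | _, Top => true
  | Elt a, Elt b => (a <= b)%O
  | _, _ => false
  end.

Lemma wb_le_refl : reflexive wb_le. Proof. by case=> //= a. Qed.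

Lemma wb_le_anti : antisymmetric wb_le.
Proof. by case=> [|a|] [|b|] //= /le_anti ->. Qed.

Lemma wb_le_trans : transitive wb_le.
Proof. by case=> [|a|] [|b|] [|c|] //=; exact: le_trans. Qed.

HB.instance Definition _ :=
  Order.Le_isPOrder.Build d (with_bounds P) wb_le_refl wb_le_anti wb_le_trans.

Lemma wb_le0x x : (Bot <= x :> with_bounds P)%O. Proof. by []. Qed.
Lemma wb_lex1 x : (x <= Top :> with_bounds P)%O. Proof. by case: x. Qed.

HB.instance Definition _ := Order.hasBottom.Build d (with_bounds P) wb_le0x.
HB.instance Definition _ := Order.hasTop.Build d (with_bounds P) wb_lex1.

End WithBoundsOrder.

HB.instance Definition _ (d : Order.disp_t) (P : finPOrderType d) :=
  Finite.on (with_bounds P).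

Section AbIndex.

(* Noncommutative polynomials over int in two letters; a word is a list of
   booleans, [false] standing for the letter a and [true] for the letter b. *)
Definition abword := fmonom bool.
Definition abpoly := malg abword int.

Definition abmon (w : seq bool) : abpoly := mkmalgU (FMonom w) 1.
Definition la : abpoly := abmon [:: false].
Definition lb : abpoly := abmon [:: true].

Definition ab_lin (h : seq bool -> abpoly) : abpoly -> abpoly :=
  mmap intr (fun w : abword => h w).

Variables (d : Order.disp_t) (P : finTBPOrderType d) (rho : P -> nat).

(* Index i : 'I_N stands for the rank i + 1, which ranges over 1, ..., N. *)
Definition flag_f (N : nat) (S : {set 'I_N}) : nat :=
  #|[pred x : #|S|.-tuple P |
      path <%O \bot%O (rcons x \top%O)
      && (map rho x == [seq (val i).+1 | i <- enum S])]|.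

Definition flag_h (N : nat) (S : {set 'I_N}) : int :=
  \sum_(T : {set 'I_N} | T \subset S) (-1) ^+ #|S :\: T| * (flag_f T)%:R.

Definition ab_index : abpoly :=
  let N := (rho \top%O).-1 in
  \sum_(S : {set 'I_N}) flag_h S *: abmon [seq i \in S | i <- enum 'I_N].

End AbIndex.

Section Phi.

Definition kappa (v : seq bool) : abpoly :=
  if v == nseq (size v) false then (la - lb) ^+ size v else 0.

Definition beta (v : seq bool) : abpoly :=
  if v == nseq (size v) true then (la - lb) ^+ size v else 0.

Definition eta (v : seq bool) : abpoly :=
  let m := count_mem true v in let k := count_mem false v in
  if v == nseq m true ++ nseq k false then 2 * (la - lb) ^+ (m + k) else 0.

Definition lambda_ub (v : seq bool) : abpoly := eta v - 2 * beta v.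

(* The segments of v from position p on that are left after deleting the
   letters at the positions (counted from 0) in the increasing list s. *)
Fixpoint segments (p : nat) (s : seq nat) (v : seq bool) : seq (seq bool) :=
  if s is i :: s' then drop p (take i v) :: segments i.+1 s' v
  else [:: drop p v].

Fixpoint ub_tail (vs : seq (seq bool)) : abpoly :=
  match vs with
  | [::] => 1
  | [:: v] => lb * lambda_ub v
  | v :: vs' => lb * eta v * ub_tail vs'
  end.

Definition ub_term (vs : seq (seq bool)) : abpoly :=
  if vs is v :: vs' then kappa v * ub_tail vs' else 0.

(* Meaningful for k >= 1; the k-fold coproduct deletes k - 1 letters. *)
Definition phi_ub_k (k : nat) (v : seq bool) : abpoly :=
  \sum_(J : {set 'I_(size v)} | #|J| == k.-1)
     ub_term (segments 0 [seq val i | i <- enum J] v).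

(* The summands with k > size v + 1 vanish: no k - 1 positions can be deleted. *)
Definition phi_ub : abpoly -> abpoly :=
  ab_lin (fun v => \sum_(1 <= k < (size v).+2) phi_ub_k k v).

End Phi.

(* Dimension of the affine hull: the largest k such that X contains k + 1
   affinely independent points. *)
Definition affdim (R : realType) (n : nat) (X : set 'rV[R]_n) : nat :=
  \max_(k < n.+1 | `[< exists (p : 'rV[R]_n) (V : 'M[R]_(k, n)),
      [/\ X p, row_free V & forall i, X (p + row i V)] >]) k.

Section Arrangement.
Variables (R : realType) (n m : nat).
(* The i-th hyperplane has normal vector row i N and equation <N_i, x> = b_i.
   A hyperplane may be listed twice: flats and faces are defined as sets of
   points, so they only depend on the set of hyperplanes. *)
Variables (N : 'M[R]_(m, n)) (b : 'rV[R]_m).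

Definition hform (i : 'I_m) (x : 'rV[R]_n) : R := (x *m N^T) 0 i.

Definition hyperplane (i : 'I_m) : set 'rV[R]_n := [set x | hform i x = b 0 i].

Definition flat (J : {set 'I_m}) : set 'rV[R]_n :=
  \bigcap_(i in [set` J]) hyperplane i.

Definition side (i : 'I_m) (s : option bool) : set 'rV[R]_n :=
  match s with
  | None => hyperplane i
  | Some true => [set x | b 0 i < hform i x]
  | Some false => [set x | hform i x < b 0 i]
  end.

Definition cell (s : {ffun 'I_m -> option bool}) : set 'rV[R]_n :=
  \bigcap_i side i (s i).

Definition flats : Type :=
  seq_sub [seq X <- [seq flat J | J : {set 'I_m}] | `[< X !=set0 >]].
HB.instance Definition _ := Finite.on flats.

Definition faces : Type :=
  seq_sub [seq F <- [seq cell s | s : {ffun 'I_m -> option bool}]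
          | `[< F !=set0 >]].
HB.instance Definition _ := Finite.on faces.

Definition flat_le (X Y : flats) : bool := `[< ssval Y `<=` ssval X >].

Lemma flat_le_refl : reflexive flat_le.
Proof. by move=> X; apply/asboolP. Qed.

Lemma flat_le_anti : antisymmetric flat_le.
Proof.
move=> X Y /andP[/asboolP YX /asboolP XY].
by apply: val_inj; apply/seteqP; split.
Qed.

Lemma flat_le_trans : transitive flat_le.
Proof.
move=> Y X Z /asboolP YX /asboolP ZY; apply/asboolP.
exact: subset_trans ZY YX.
Qed.

HB.instance Definition _ := Order.Le_isPOrder.Build Order.default_display flats
  flat_le_refl flat_le_anti flat_le_trans.

Definition face_le (F G : faces) : bool := `[< ssval F `<=` closure (ssval G) >].

Lemma face_le_refl : reflexive face_le.
Proof. by move=> F; apply/asboolP; exact: subset_closure. Qed.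

Lemma face_le_trans : transitive face_le.
Proof.
move=> G F H /asboolP FG /asboolP GH; apply/asboolP.
apply: (subset_trans FG).
rewrite [X in _ `<=` X](closure_id _).1; last exact: closed_closure.
exact: closureS.
Qed.

Lemma hform_continuous i : continuous (hform i).
Proof.
move=> x; have -> : hform i = fun y : 'rV[R]_n => \sum_j y 0 j * N i j.
  by apply/funext => y; rewrite /hform mxE; apply: eq_bigr => j _; rewrite mxE.
apply: continuous_big => [|j _ {}x]; first exact: add_continuous.
by apply: continuousM; [exact: coord_continuous | exact: cst_continuous].
Qed.

Lemma face_signP (F : faces) : exists2 s, ssval F = cell s & exists x, cell s x.
Proof.
case: F => F /= Fin; move: (Fin); rewrite mem_filter => /andP[/asboolP F0].
by case/mapP => s _ E; exists s => //; rewrite -E.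
Qed.

Lemma side_closure i s t x : closure (side i t) x -> side i s x ->
  s = None \/ s = t.
Proof.
have cl (A : set R) : closed A -> side i t `<=` hform i @^-1` A ->
    closure (side i t) x -> A (hform i x).
  move=> cA /closureS sA /sA.
  rewrite -(closure_id _).1 //; apply: closed_comp => // y _.
  exact: hform_continuous.
case: t cl => [[]|] cl xt; case: s => [[]|]; try by [left|right].
- have := cl _ (@closed_ge _ (b 0 i)) (fun y h => ltW h) xt.
  by rewrite /= leNgt => /negP h /h.
- have := cl _ (@closed_le _ (b 0 i)) (fun y h => ltW h) xt.
  by rewrite /= leNgt => /negP h /h.
- have := cl _ (@closed_eq _ (b 0 i)) (fun y h => h) xt.
  by move=> /= -> ; rewrite ltxx.
- have := cl _ (@closed_eq _ (b 0 i)) (fun y h => h) xt.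
  by move=> /= -> ; rewrite ltxx.
Qed.

Lemma face_le_anti : antisymmetric face_le.
Proof.
move=> F G /andP[/asboolP FG /asboolP GF]; apply: val_inj => /=.
have [s Fs [x xs]] := face_signP F; have [t Gt [y yt]] := face_signP G.
rewrite Fs Gt in FG GF *; congr cell; apply/ffunP => i.
have side_cl u z : closure (cell u) z -> closure (side i (u i)) z.
  by apply: closureS => w; apply.
have [] := side_closure (side_cl _ _ (FG _ xs)) (xs i I) => // s0.
have [] := side_closure (side_cl _ _ (GF _ yt)) (yt i I) => // t0.
by rewrite s0 t0.
Qed.

HB.instance Definition _ := Order.Le_isPOrder.Build Order.default_display faces
  face_le_refl face_le_anti face_le_trans.

Definition unbounded_faces : Type :=
  {F : faces | `[< ~ bounded_set (ssval F) >]}.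
HB.instance Definition _ := Finite.on unbounded_faces.
HB.instance Definition _ := SubType.on unbounded_faces.
HB.instance Definition _ :=
  [SubChoice_isSubPOrder of unbounded_faces by <: with Order.default_display].

Definition essential : Prop := row_full N.

Definition noncentral : Prop := \bigcap_i hyperplane i = set0.

(* The intersection lattice with a new minimum: [Bot] is the new minimum and
   [Top] is the empty set. *)
Definition intersection_lattice0 := with_bounds flats.
HB.instance Definition _ := Order.FinTBPOrder.on intersection_lattice0.

Definition intersection_rank (x : intersection_lattice0) : nat :=
  match x with
  | Bot => 0
  | Elt X => (n - affdim (ssval X) + 1)%N
  | Top => (n + 2)%N
  end.

(* The dual of the face poset: [Bot] is the maximum of the face poset and
   [Top] is the empty face. *)
Definition dual_face_poset := with_bounds faces^d.
HB.instance Definition _ := Order.FinTBPOrder.on dual_face_poset.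

Definition dual_face_rank (x : dual_face_poset) : nat :=
  match x with
  | Bot => 0
  | Elt F => (n + 1 - affdim (ssval F))%N
  | Top => (n + 2)%N
  end.

Definition unbounded_poset := with_bounds unbounded_faces^d.
HB.instance Definition _ := Order.FinTBPOrder.on unbounded_poset.

Definition unbounded_rank (x : unbounded_poset) : nat :=
  match x with
  | Bot => dual_face_rank Bot
  | Elt F => dual_face_rank (Elt (val F))
  | Top => (n + 2)%N
  end.

End Arrangement.

(* Main.v *)
(**
Write c = a - b. Expanding h_S shows that the ab-index of a poset is the sum of
the words in c and b attached to its chains, so that Psi(Q) and
Psi(L u {0}) satisfy the same kind of recursion, on the dimension of a face or
of a flat. Read letter by letter, phi_ub is a finite automaton, whose states
give linear maps satisfying simple rules for left multiplication by c and b.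
By induction on the dimension of a flat X, the image of the contribution of X
is the sum of the contributions of the unbounded faces that span X; comparing
coefficients, this amounts to two Euler relations: over the unbounded faces G
contained in X, and over those having a given unbounded face in their closure,
the sum of (-1)^(dim G) is (-1)^(dim X) - 1 and (-1)^(dim X), respectively.
Both follow from the fact that two functions on the cells of the
subarrangements are additive when a cell is cut by one more hyperplane: the
signed indicator of being nonempty, and the signed indicator of being nonempty
with a linear recession cone, which detects bounded cells.
*)
From HB Require Import structures.
Require Import Defs.
From mathcomp Require Import all_boot all_order all_algebra.
From mathcomp Require Import all_classical all_reals all_analysis.
From mathcomp Require Import finmap.
From mathcomp.multinomials Require Import -(notations) monalg.
From mathcomp Require Import ring lra zify.
Set Implicit Arguments.
Unset Strict Implicit.
Unset Printing Implicit Defensive.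
Import Order.TTheory GRing.Theory Num.Theory.
Import numFieldNormedType.Exports.
Local Open Scope ring_scope.

(** * The automaton of phi_ub *)

Definition lc : abpoly := la - lb.

Lemma abmon_nil : abmon [::] = 1.
Proof. by rewrite /abmon -fmoneE. Qed.

Lemma abmon_cons x v : abmon (x :: v) = (if x then lb else la) * abmon v.
Proof.
suff E y : abmon (y :: v) = abmon [:: y] * abmon v by rewrite E; case: x.
by rewrite /abmon malgM_def fgmulUU mulr1 /mmul /= fmmulE.
Qed.

HB.instance Definition _ h :=
  GRing.Additive.copy (ab_lin h) (mmap intr (fun w : abword => h w)).

Lemma ab_lin_mon h w : ab_lin h (abmon w) = h w.
Proof. by rewrite /ab_lin mmapU mul1r. Qed.

Lemma abpolyE (p : abpoly) :
  p = \sum_(k <- msupp p) abmon (k : abword) *~ mcoeff k p.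
Proof.
rewrite {1}[p]monalgE; apply: eq_bigr => k _.
by rewrite /abmon fmK -raddfMz /= intz.
Qed.

Lemma ab_lin_letter h x p :
  ab_lin h ((if x then lb else la) * p) = ab_lin (fun w => h (x :: w)) p.
Proof.
rewrite [in LHS](abpolyE p) [in RHS](abpolyE p) mulr_sumr !raddf_sum.
apply: eq_bigr => k _.
by rewrite mulrzAr !raddfMz /= -abmon_cons !ab_lin_mon.
Qed.

Lemma ab_lin_lin h f g (x y : abpoly) :
  (forall w, h w = x * f w + y * g w) ->
  forall p, ab_lin h p = x * ab_lin f p + y * ab_lin g p.
Proof.
move=> E p; rewrite (abpolyE p) !raddf_sum !mulr_sumr -big_split.
apply: eq_bigr => k _.
by rewrite !raddfMz /= !ab_lin_mon E mulrzDl !mulrzAr.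
Qed.

(* [phi_ub] reads words from left to right: [phiK] is its value on a word read
   inside the first segment, and [phiE s] its value on a word read inside a
   later segment, where [s] says that the a-part of that segment is reached. *)
Fixpoint phiE (s : bool) (w : seq bool) : abpoly :=
  if w is x :: w' then
    (if s && x then 0 else lc * phiE (s || ~~ x) w') + 2 * lb * phiE false w'
  else if s then 2 else 0.

Fixpoint phiK (w : seq bool) : abpoly :=
  if w is x :: w' then
    (if x then 0 else lc * phiK w') + lb * phiE false w'
  else 1.

(** On the empty word this state gives 0, since [eta] and [2 * beta] cancel there. *)
Definition linEB : abpoly -> abpoly := ab_lin (phiE false).
(** Left multiplication by [lc] cancels the terms that delete the first letter and leaves a
    difference of states; [linEB] and [linD] thus form a closed system. *)
Definition linD : abpoly -> abpoly :=
  ab_lin (fun w => phiE true w - phiE false w).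
Definition linK : abpoly -> abpoly := ab_lin phiK.

HB.instance Definition _ := GRing.Additive.copy linEB (ab_lin (phiE false)).
HB.instance Definition _ :=
  GRing.Additive.copy linD (ab_lin (fun w => phiE true w - phiE false w)).
HB.instance Definition _ := GRing.Additive.copy linK (ab_lin phiK).

Lemma ab_lin_lc h p :
  ab_lin h (lc * p) = ab_lin (fun w => h (false :: w) - h (true :: w)) p.
Proof.
rewrite /lc mulrBl raddfB /= (ab_lin_letter h false) (ab_lin_letter h true).
symmetry; rewrite -[X in X - _]mul1r -mulN1r.
by apply: ab_lin_lin => w; rewrite mul1r mulN1r.
Qed.

Lemma ab_lin_lb h p : ab_lin h (lb * p) = ab_lin (fun w => h (true :: w)) p.
Proof. exact: (ab_lin_letter h true). Qed.

Lemma ab_linM h f (x : abpoly) : (forall w, h w = x * f w) ->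
  forall p, ab_lin h p = x * ab_lin f p.
Proof.
move=> E p; rewrite (@ab_lin_lin h f f x 0) ?mul0r ?addr0 // => w.
by rewrite mul0r addr0.
Qed.

Lemma addr_cancelr (V : zmodType) (u v w : V) : u + w - (v + w) = u - v.
Proof. by rewrite opprD addrACA subrr addr0. Qed.

Lemma linEB_lc p : linEB (lc * p) = lc * linD p.
Proof.
rewrite /linEB ab_lin_lc; apply: ab_linM => w /=.
by rewrite (addr_cancelr (lc * _)) -(mulrBr lc).
Qed.

Lemma linEB_lb p : linEB (lb * p) = (lc + 2 * lb) * linEB p.
Proof.
rewrite /linEB ab_lin_lb; apply: ab_linM => w /=.
by rewrite (mulrDl lc (2 * lb)).
Qed.

Lemma linD_lc p : linD (lc * p) = lc * linEB p.
Proof.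
rewrite /linD ab_lin_lc; apply: ab_linM => w /=.
rewrite (subrr (lc * phiE true w + _)) (sub0r (0 + _ - _)) (opprB (0 + _)).
by rewrite (addr_cancelr (lc * _)) (subr0 (lc * _)).
Qed.

Lemma linD_lb p : linD (lb * p) = - lc * linEB p.
Proof.
rewrite /linD ab_lin_lb; apply: ab_linM => w /=.
by rewrite (addr_cancelr 0) (sub0r (lc * _)) (mulNr lc).
Qed.

Lemma linK_lc p : linK (lc * p) = lc * linK p.
Proof.
rewrite /linK ab_lin_lc; apply: ab_linM => w /=.
by rewrite (addr_cancelr (lc * _)) (subr0 (lc * _)).
Qed.

Lemma linK_lb p : linK (lb * p) = lb * linEB p.
Proof. by rewrite /linK ab_lin_lb; apply: ab_linM => w /=; rewrite add0r. Qed.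

Lemma linEB1 : linEB 1 = 0.
Proof. by rewrite -abmon_nil /linEB ab_lin_mon. Qed.

Lemma linD1 : linD 1 = 2.
Proof.
rewrite -[X in linD X]abmon_nil /linD ab_lin_mon; exact: (subr0 (2 : abpoly)).
Qed.

Lemma linK1 : linK 1 = 1.
Proof. by rewrite -[X in linK X]abmon_nil /linK ab_lin_mon. Qed.

(** * Transfer from flats to unbounded faces *)

Section Alternation.
Variables (R : nzRingType) (c b : R) (EB D K : {additive R -> R}).
Hypothesis EB_c : forall p, EB (c * p) = c * D p.
Hypothesis EB_b : forall p, EB (b * p) = (c + 2 * b) * EB p.
Hypothesis D_c : forall p, D (c * p) = c * EB p.
Hypothesis D_b : forall p, D (b * p) = - c * EB p.
Hypothesis K_c : forall p, K (c * p) = c * K p.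
Hypothesis K_b : forall p, K (b * p) = b * EB p.
Hypothesis EB1 : EB 1 = 0.
Hypothesis D1 : D 1 = 2.
Hypothesis K1 : K 1 = 1.

Lemma K_cX k p : K (c ^+ k * p) = c ^+ k * K p.
Proof.
by elim: k => [|k IH]; rewrite ?expr0 ?mul1r // exprS -!mulrA K_c IH.
Qed.

(** Each factor [c] swaps [EB] and [D], so only the parity of the exponent matters. *)
Lemma EB_D_cX k p :
  EB (c ^+ k * p) = c ^+ k * (if odd k then D p else EB p) /\
  D (c ^+ k * p) = c ^+ k * (if odd k then EB p else D p).
Proof.
elim: k => [|k [IH1 IH2]]; rewrite ?expr0 ?mul1r // exprS -!mulrA.
by rewrite EB_c D_c IH1 IH2 /=; case: odd.
Qed.

Lemma EB_cX k : EB (c ^+ k) = c ^+ k *~ (1 - (-1) ^+ k).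
Proof.
rewrite -[in LHS](mulr1 (c ^+ k)) (EB_D_cX k 1).1 EB1 D1.
rewrite -[in RHS]signr_odd; case: odd; first by rewrite expr1 opprK mulr_natr.
by rewrite expr0 subrr mulr0 mulr0z.
Qed.

(** The sign merges two cases: in front of [EB p], an even power leaves [c + 2 * b] and an odd power
    leaves [- c]. *)
Lemma EB_cXb k p : EB (c ^+ k * (b * p)) =
  (c ^+ k.+1 * EB p) *~ (-1) ^+ k + (c ^+ k * (b * EB p)) *~ (1 + (-1) ^+ k).
Proof.
rewrite (EB_D_cX k _).1 EB_b D_b -[(-1) ^+ k]signr_odd exprSr.
case: odd.
  by rewrite expr1 subrr mulr0z addr0 mulrN1z mulNr mulrN mulrA.
by rewrite expr0 mulr1z mulrDl mulrDr -!mulrA mulr_natl mulrnAr.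
Qed.

(* [A] models the flats, [B] the unbounded faces and [sp] the affine span:
   [leA X Y] means that [Y] is contained in [X], and [leB G H] that [H] is
   contained in the closure of [G]. *)
Variables (n : nat) (A B : finType).
Variables (leA : rel A) (leB : rel B) (dA : A -> nat) (dB : B -> nat).
Variables (sp : B -> A) (FA : A -> R) (FB : B -> R).
Hypothesis leA_refl : reflexive leA.
Hypothesis leA_trans : transitive leA.
Hypothesis leA_dim : forall X Y, X != Y -> leA X Y -> (dA Y < dA X)%N.
Hypothesis leB_refl : reflexive leB.
Hypothesis leB_sp : forall G H, leB G H -> leA (sp G) (sp H).
Hypothesis leB_dim : forall G H, G != H -> leB G H -> sp G != sp H.
Hypothesis dB_sp : forall G, dB G = dA (sp G).
Hypothesis FAE : forall X, FA X = c ^+ dA X +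
  \sum_(Y | (X != Y) && leA X Y) c ^+ (dA X - dA Y).-1 * (b * FA Y).
Hypothesis FBE : forall G, FB G = c ^+ dB G +
  \sum_(H | (G != H) && leB G H) c ^+ (dB G - dB H).-1 * (b * FB H).
Hypothesis euler_all : forall X,
  \sum_(G | leA X (sp G)) (-1) ^+ dB G = (-1) ^+ dA X - 1 :> int.
Hypothesis euler_local : forall X I, leA X (sp I) ->
  \sum_(G | leA X (sp G) && leB G I) (-1) ^+ dB G = (-1) ^+ dA X :> int.

(** Strong induction on [dA X]. Both sides are expanded in [c ^+ d] and in the terms
    [c ^+ _ * (b * FB I)]; the coefficients agree by [euler_all] and by [euler_local]
    respectively. *)
Lemma EB_FA X : EB (FA X) = \sum_(G | sp G == X) FB G.
Proof.
have [k] := ubnP (dA X); elim: k X => // k IH X leXk.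
pose d := dA X.
(* The induction hypothesis replaces [EB (FA Y)] by the faces spanning [Y], which merges two sums
   into one over the faces whose span is strictly inside [X]. *)
have -> : EB (FA X) = c ^+ d *~ (1 - (-1) ^+ d) +
   \sum_(H | (X != sp H) && leA X (sp H))
     ((c ^+ (d - dB H) * FB H) *~ (-1) ^+ (d - dB H).-1
      + (c ^+ (d - dB H).-1 * (b * FB H)) *~ (1 + (-1) ^+ (d - dB H).-1)).
  rewrite FAE raddfD raddf_sum EB_cX; congr (_ + _).
  rewrite (partition_big sp (fun Y => (X != Y) && leA X Y)) //=.
  apply: eq_bigr => Y /andP[XY lXY].
  have lt := leA_dim XY lXY.
  rewrite EB_cXb IH; last by lia.
  rewrite prednK ?subn_gt0 // !mulr_sumr !mulrz_suml -big_split /=.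
  apply: eq_big => [H|H /eqP <-]; last by rewrite dB_sp.
  by case: eqP => [->|]; rewrite ?XY ?lXY ?andbF.
(* After exchanging sums, [H] occurs once for each face [G] that spans [X] and has [H] in its
   closure. *)
have -> : \sum_(G | sp G == X) FB G = c ^+ d *~ (#|[pred G | sp G == X]|%:Z)
   + \sum_(H | (X != sp H) && leA X (sp H))
      (c ^+ (d - dB H).-1 * (b * FB H)) *~ #|[pred G | (sp G == X) && leB G H]|.
  rewrite (eq_bigr (fun G => c ^+ d +
      \sum_(H | (X != sp H) && leA X (sp H) && leB G H)
        c ^+ (d - dB H).-1 * (b * FB H))); last first.
    move=> G /eqP spG; rewrite FBE {1}dB_sp spG; congr (_ + _).
    apply: eq_big => [H|H _]; last by rewrite dB_sp spG.
    apply/andP/andP => [[GH lGH]|[/andP[XH lXH] lGH]].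
      by split=> //; rewrite -spG leB_sp // leB_dim.
    by split=> //; apply: contraNneq XH => <-; rewrite spG.
  rewrite big_split /= sumr_const; congr (_ + _).
  rewrite (exchange_big_dep (fun H => (X != sp H) && leA X (sp H))) /=; last first.
    by move=> G H _ /andP[].
  apply: eq_bigr => H /andP[XH lXH]; rewrite XH lXH /= sumr_const.
  by congr (_ *+ _); apply: eq_card => G; rewrite !inE.
have lt H : (X != sp H) && leA X (sp H) -> (dB H < d)%N.
  by move=> /andP[XH lXH]; rewrite dB_sp leA_dim.
(* Expanding FB H in the first summand, all the terms are multiples of c ^+ d
   or of some c ^+ _ * (b * FB I), whose coefficients are Euler sums. *)
have -> : \sum_(H | (X != sp H) && leA X (sp H))
     ((c ^+ (d - dB H) * FB H) *~ (-1) ^+ (d - dB H).-1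
      + (c ^+ (d - dB H).-1 * (b * FB H)) *~ (1 + (-1) ^+ (d - dB H).-1)) =
  c ^+ d *~ (\sum_(H | (X != sp H) && leA X (sp H)) (-1) ^+ (d - dB H).-1)
  + \sum_(I | (X != sp I) && leA X (sp I)) (c ^+ (d - dB I).-1 * (b * FB I)) *~
     (1 + (-1) ^+ (d - dB I).-1 +
      \sum_(H | ((X != sp H) && leA X (sp H)) && ((H != I) && leB H I))
         (-1) ^+ (d - dB H).-1).
  rewrite big_split /=.
  under [X in X + _]eq_bigr => H ltH.
    rewrite FBE mulrDr -exprD subnK ?(ltnW (lt _ ltH)) // mulrzDl mulr_sumr mulrz_suml.
    over.
  rewrite big_split /= -mulrz_sumr -addrA; congr (_ + _).
  under [RHS]eq_bigr do rewrite mulrzDr mulrz_sumr.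
  rewrite [RHS]big_split /= addrC; congr (_ + _).
  rewrite (exchange_big_dep (fun I => (X != sp I) && leA X (sp I))) /=; last first.
    move=> H I /andP[XH lXH] /andP[HI lHI]; have lt1 := leA_dim XH lXH.
    rewrite (leA_trans lXH (leB_sp lHI)) andbT; apply: contraTneq lt1 => ->.
    by rewrite -leqNgt -!dB_sp ltnW // !dB_sp leA_dim ?leB_dim ?leB_sp.
  apply: eq_bigr => I _; apply: eq_bigr => H /andP[ltH /andP[HI lHI]].
  have ltI : (dB I < dB H)%N by rewrite !dB_sp leA_dim ?leB_dim ?leB_sp.
  rewrite mulrA -exprD; congr (_ ^+ _ * _ *~ _).
  by have := lt _ ltH; lia.
(* The predecessor shifts the parity, hence the minus sign; this needs [dB H < d]. *)
have sgnE H : (X != sp H) && leA X (sp H) ->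
    (-1) ^+ (d - dB H).-1 = - (-1) ^+ d * (-1) ^+ dB H :> int.
  move=> /lt ltH; have : (d = ((d - dB H).-1 + dB H).+1)%N by lia.
  move: (_.-1) => e ->; rewrite exprS mulN1r opprK exprD -mulrA -exprD addnn.
  by rewrite -[(-1) ^+ _.*2]signr_odd odd_double mulr1.
(* The faces spanning [X] all have dimension [d], so an Euler sum isolates their number. *)
have split_sum (P : pred B) : (forall G, P G -> leA X (sp G)) ->
    \sum_(G | P G) (-1) ^+ dB G = (-1) ^+ d *+ #|[pred G | (sp G == X) && P G]|
     + \sum_(G | ((X != sp G) && leA X (sp G)) && P G) (-1) ^+ dB G :> int.
  move=> PX; rewrite (bigID (fun G => sp G == X)) /=; congr (_ + _).
    rewrite (eq_bigr (fun=> (-1) ^+ d)) => [|G /andP[_ /eqP spG]]; last first.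
      by rewrite dB_sp spG.
    rewrite sumr_const; congr (_ *+ _).
    by apply: eq_card => G; rewrite !inE andbC.
  by apply: eq_bigl => G; rewrite eq_sym andbC; case: (boolP (P G)) => [/PX ->|];
     rewrite ?andbT ?andbF.
have sdd : (-1) ^+ d * (-1) ^+ d = 1 :> int by rewrite -exprD addnn -signr_odd odd_double.
rewrite addrA -mulrzDr; congr (_ + _).
  congr (_ *~ _).
  have := euler_all X; rewrite split_sum // -/d.
  rewrite (eq_bigr _ sgnE) -mulr_sumr.
  rewrite (eq_bigl (fun G => (X != sp G) && leA X (sp G))) => [|G]; last first.
    by rewrite -andbA andbb.
  rewrite (@eq_card _ [pred G | (sp G == X) && leA X (sp G)]
             [pred G | sp G == X]); last first.
    by move=> G; rewrite !inE; case: eqP => // ->; rewrite leA_refl.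
  move: (\sum_(_ | _) _) #|_| ((-1) ^+ d) sdd => S' k0 s sdd; rewrite -mulr_natr => E.
  have -> : S' = s - 1 - s * k0%:R by rewrite -E addrAC subrr add0r.
  (* The sign [s] now enters only through its square, which is 1. *)
  transitivity (1 - s * s + s * s * k0%:R); first by ring.
  by rewrite sdd natz subrr add0r mul1r.
apply: eq_bigr => I /andP[XI lXI]; congr (_ *~ _).
(* The local Euler relation, split into the faces spanning [X], the face [I] itself and the
   others. *)
have E : (-1) ^+ d *+ #|[pred G | (sp G == X) && leB G I]| + ((-1) ^+ dB I +
    \sum_(H | (X != sp H) && leA X (sp H) && ((H != I) && leB H I)) (-1) ^+ dB H)
    = (-1) ^+ d :> int.
  rewrite -[RHS](euler_local lXI) [RHS]split_sum => [|G /andP[]//]; congr (_ + _).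
    congr (_ *+ _).
    by apply: eq_card => G; rewrite !inE; case: eqP => // ->; rewrite leA_refl.
  rewrite [RHS](bigD1 I) /=; last by rewrite XI lXI leB_refl.
  congr (_ + _); apply: eq_bigl => G.
  by case: (X == sp G); case: (leA X (sp G)); case: (G == I); case: (leB G I).
rewrite (@sgnE I) ?XI // (eq_bigr (fun H => - (-1) ^+ d * (-1) ^+ dB H)); last first.
  by move=> H /andP[ltH _]; rewrite sgnE.
rewrite -mulr_sumr; move: E.
move: (\sum_(_ | _) _) #|_| ((-1) ^+ d) sdd ((-1) ^+ dB I) => S' k0 s sdd t.
rewrite -mulr_natr => E.
have -> : S' = s - t - s * k0%:R by rewrite -[X in X - t - _]E; ring.
transitivity (1 - s * s + s * s * k0%:R); first by ring.
by rewrite sdd natz subrr add0r mul1r.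
Qed.

(** [K] passes through powers of [c] and becomes [EB] behind the first [b], where [EB_FA]
    applies. *)
Lemma K_bottom (FA0 FB0 : R) :
  FA0 = c ^+ n.+1 + \sum_X c ^+ (n - dA X) * (b * FA X) ->
  FB0 = c ^+ n.+1 + \sum_G c ^+ (n - dB G) * (b * FB G) ->
  FB0 = K FA0.
Proof.
move=> -> ->; rewrite raddfD raddf_sum -[in RHS](mulr1 (c ^+ _)) K_cX K1 mulr1.
congr (_ + _); rewrite (partition_big sp predT) //=; apply: eq_bigr => X _.
rewrite K_cX K_b EB_FA !mulr_sumr; apply: eq_bigr => G /eqP <-.
by rewrite dB_sp.
Qed.

End Alternation.

(** * Chains and words *)

Lemma sum_tuple_cons (V : nmodType) (T : finType) k (g : seq T -> V) :
  \sum_(t : k.+1.-tuple T) g t = \sum_x \sum_(t : k.-tuple T) g (x :: t).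
Proof.
rewrite pair_bigA /= (reindex (fun p : T * k.-tuple T => cons_tuple p.1 p.2)) //.
exists (fun t => (thead t, behead_tuple t)) => [[x t] _|t _] /=.
  by congr (_, _); apply: val_inj.
by rewrite [t in RHS]tuple_eta; apply: val_inj.
Qed.

(** * Sums over words and Moebius inversion *)

Section WordSums.
Variable V : nmodType.

Fixpoint wsum (k : nat) (g : seq bool -> V) : V :=
  if k is k'.+1 then
    wsum k' (fun w => g (false :: w)) + wsum k' (fun w => g (true :: w))
  else g [::].

Lemma eq_wsum k (g h : seq bool -> V) :
  (forall w, size w = k -> g w = h w) -> wsum k g = wsum k h.
Proof.
elim: k g h => [|k IH] g h E /=; first exact: E.
by congr (_ + _); apply: IH => w sw; apply: E; rewrite /= sw.
Qed.

Lemma wsum_tuple k g : wsum k g = \sum_(t : k.-tuple bool) g t.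
Proof.
elim: k g => [|k IH] g /=.
  by rewrite (big_pred1 [tuple]) // => t; apply/esym/eqP; rewrite [t]tuple0.
by rewrite sum_tuple_cons big_bool /= !IH addrC.
Qed.

Lemma wsum_set k g :
  \sum_(S : {set 'I_k}) g [seq i \in S | i <- enum 'I_k] = wsum k g.
Proof.
rewrite wsum_tuple (reindex (fun S : {set 'I_k} => [tuple i \in S | i < k])) //=.
exists (fun t => [set i | tnth t i]) => [S _|t _].
  by apply/setP => i; rewrite inE tnth_mktuple.
by apply: eq_from_tnth => i; rewrite tnth_mktuple inE.
Qed.

Lemma wsumD k g h : wsum k (fun w => g w + h w) = wsum k g + wsum k h.
Proof. by elim: k g h => //= k IH g h; rewrite !IH addrACA. Qed.

Lemma wsum_sum k (I : finType) (P : pred I) g :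
  wsum k (fun w => \sum_(i | P i) g i w) = \sum_(i | P i) wsum k (g i).
Proof. by elim: k g => //= k IH g; rewrite !IH big_split. Qed.

End WordSums.

Lemma wsum_mulr (R : pzSemiRingType) k (x : R) g :
  wsum k (fun w => x * g w) = x * wsum k g.
Proof. by elim: k g => //= k IH g; rewrite !IH mulrDr. Qed.

Lemma wsum_mulrz (V : zmodType) k (z : int) (g : seq bool -> V) :
  wsum k (fun w => g w *~ z) = wsum k g *~ z.
Proof. by elim: k g => //= k IH g; rewrite !IH mulrzDl. Qed.

(* The coefficient of f_T in h_S, for the words [w] of S and [v] of T. *)
Definition sgnw (w v : seq bool) : int :=
  \prod_(p <- zip w v) (if p.1 then if p.2 then 1 else -1 else (~~ p.2)%:R).

Lemma sgnw_cons x w y v : sgnw (x :: w) (y :: v) =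
  (if x then if y then 1 else -1 else (~~ y)%:R) * sgnw w v.
Proof. by rewrite /sgnw big_cons. Qed.

Lemma sgnw_set k (S T : {set 'I_k}) :
  sgnw [seq i \in S | i <- enum 'I_k] [seq i \in T | i <- enum 'I_k] =
  if T \subset S then (-1) ^+ #|S :\: T| else 0.
Proof.
rewrite /sgnw zip_map big_map big_enum /=.
case: ifPn => [/fintype.subsetP sTS|/subsetPn[i iT iS]]; last first.
  by rewrite (bigD1 i) //= iT (negbTE iS) /= mul0r.
rewrite (bigID (mem (S :\: T))) /= [X in _ * X]big1 ?mulr1.
  rewrite -prodr_const; apply: eq_bigr => i; rewrite !inE => /andP[iT ->].
  by rewrite (negbTE iT).
move=> i; rewrite !inE; case: (boolP (i \in T)) => [/sTS ->|] //=.
by case: (i \in S).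
Qed.

Section NcMonomials.
Variables (R : pzRingType).

Fixpoint ncmon (a b : R) (w : seq bool) : R :=
  if w is x :: w' then (if x then b else a) * ncmon a b w' else 1.

(** Moebius inversion one letter at a time: summing over the letter of [w], a letter a of [v]
    collects [a - b] and a letter b collects [b]. *)
Lemma ncmon_sgnw (a b : R) k (f : seq bool -> int) :
  wsum k (fun w => wsum k (fun v => ncmon a b w *~ (sgnw w v * f v)))
  = wsum k (fun v => ncmon (a - b) b v *~ f v).
Proof.
elim: k f => [|k IH] f /=; first by rewrite /sgnw big_nil mul1r.
pose F x := wsum k (fun v => ncmon (a - b) b v *~ f (x :: v)).
have E x y : wsum k (fun w => wsum k (fun v =>
      ((if x then b else a) * ncmon a b w) *~ (sgnw (x :: w) (y :: v) * f (y :: v)))) =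
    ((if x then b else a) * F y) *~ (if x then if y then 1 else -1 else (~~ y)%:R).
  rewrite /F -IH; move: (if x then _ else a) => l.
  set s : int := (X in _ = _ *~ X).
  rewrite -wsum_mulr -wsum_mulrz; apply: eq_wsum => w _.
  rewrite -wsum_mulr -wsum_mulrz; apply: eq_wsum => v _.
  by rewrite sgnw_cons -/s mulrzAr -mulrzA; congr (_ *~ _); ring.
rewrite !wsumD !(E false, E true) /= mulr0z mulr1z !mulrN1z addr0.
have E' l x : wsum k (fun v => (l * ncmon (a - b) b v) *~ f (x :: v)) = l * F x.
  by rewrite -wsum_mulr; apply: eq_wsum => v _; rewrite mulrzAr.
by rewrite !E' mulrBl addrA addrAC.
Qed.

End NcMonomials.

Lemma abmon_ncmon w : abmon w = ncmon la lb w.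
Proof. by elim: w => [|x w IH]; rewrite ?abmon_nil // abmon_cons IH. Qed.

(** * Generating functions of chains *)

Section Chains.
Variables (d : Order.disp_t) (P : finTBPOrderType d) (rho : P -> nat).

Fixpoint chains (x : P) (rs : seq nat) : nat :=
  if rs is r :: rs' then (\sum_(y | (x < y)%O && (rho y == r)) chains y rs')%N
  else (x < \top)%O.

Lemma card_chains x rs :
  #|[pred t : (size rs).-tuple P |
      path <%O x (rcons t \top%O) && (map rho t == rs)]| = chains x rs.
Proof.
rewrite -sum1_card big_mkcond /=.
elim: rs x => [|r rs IH] x /=.
  rewrite (big_pred1 [tuple]) => [|t]; last by apply/esym/eqP; rewrite [t]tuple0.
  by rewrite inE /= !andbT; case: (x < _)%O.
rewrite (@sum_tuple_cons nat _ _ (fun t => if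
   path <%O x (rcons t \top%O) && (map rho t == r :: rs) then 1%N else 0%N)).
rewrite [RHS]big_mkcond /=; apply: eq_bigr => y _.
case: ifPn => [/andP[xy /eqP ry]|]; last first.
  by rewrite negb_and => H; apply: big1 => t _; rewrite eqseq_cons;
    case/orP: H => /negbTE ->; rewrite ?andbF.
rewrite -IH; apply: eq_bigr => t _.
by rewrite inE xy /= eqseq_cons ry eqxx.
Qed.

Lemma flag_f_chains k (S : {set 'I_k}) : flag_f rho S =
  chains \bot%O (mask [seq i \in S | i <- enum 'I_k] (iota 1 k)).
Proof.
have E : [seq (val i).+1 | i <- enum S] =
    mask [seq i \in S | i <- enum 'I_k] (iota 1 k).
  rewrite -[1%N]addn0 iotaDl -val_enum_ord -map_comp -map_mask; congr map.
  by rewrite -filter_mask enumT.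
rewrite -E -card_chains /flag_f.
by have <- : #|S| = size [seq (val i).+1 | i <- enum S] by rewrite size_map -cardE.
Qed.

Variable R : pzRingType.
Variables (c b : R).

(* Sum of the words of the chains above [x] whose ranks are among the last [k]
   ranks below that of the top. *)
Fixpoint chain_gf (k : nat) (x : P) : R :=
  let N := (rho \top%O).-1 in
  if k is k'.+1 then c * chain_gf k' x
    + b * \sum_(y | (x < y)%O && (rho y == (N - k')%N)) chain_gf k' y
  else 1.

Hypothesis rho_top : forall x, (rho x < rho \top%O)%N -> (x < \top)%O.

(** The word [v] marks the ranks used by a chain; its first letter concerns the lowest of the last
    [k] ranks, which [c] skips and [b] uses. *)
Lemma chain_gfE k x : (k < rho \top%O)%N -> (x < \top)%O ->
  wsum k (fun v => ncmon c b v *~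
    chains x (mask v (iota ((rho \top%O).-1 - k).+1 k))) = chain_gf k x.
Proof.
set N := (rho _).-1; elim: k x => [|k IH] x kN xT /=; first by rewrite xT.
have Nk : ((N - k.+1).+1 = N - k)%N by rewrite /N; lia.
rewrite Nk -/N; congr (_ + _).
  by rewrite -IH //; [rewrite -wsum_mulr; apply: eq_wsum => v _; rewrite mulrzAr | lia].
transitivity (wsum k (fun w => b * \sum_(y | (x < y)%O && (rho y == (N - k)%N))
    ncmon c b w *~ chains y (mask w (iota (N - k).+1 k)))).
  by apply: eq_wsum => v _; rewrite -mulrzAr -mulrz_sumr (big_morph Posz PoszD erefl).
rewrite wsum_mulr wsum_sum; congr (_ * _); apply: eq_bigr => y /andP[xy /eqP ry].
by rewrite -IH //; [lia | apply: rho_top; rewrite ry /N; lia].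
Qed.

(** Chains are grouped by their lowest element [y]; the exponent counts the ranks skipped before
    it. *)
Lemma chain_gf_closed k x : (k < rho \top%O)%N ->
  let N := (rho \top%O).-1 in
  chain_gf k x = c ^+ k + \sum_(y | (x < y)%O && (N - k < rho y <= N)%N)
    c ^+ (rho y - (N - k)).-1 * (b * chain_gf (N - rho y) y).
Proof.
move=> kN N; elim: k kN => [|k IH] kN.
  rewrite big_pred0 ?addr0 // => y.
  by case: (x < y)%O => //=; lia.
rewrite /= -/N IH; last by lia.
rewrite mulrDr -exprS -addrA; congr (_ + _).
(* Elements of the lowest admissible rank come from the letter [b], the others from the induction
   hypothesis. *)
rewrite [RHS](bigID (fun y => rho y == (N - k)%N)) /= addrC; congr (_ + _).
  rewrite mulr_sumr; apply: eq_big => [y|y /andP[_ /eqP ry]].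
    by case: (x < y)%O => //=; rewrite /N; lia.
  rewrite ry; have -> : (N - (N - k) = k)%N by rewrite /N; lia.
  have -> : ((N - k - (N - k.+1)).-1 = 0)%N by rewrite /N; lia.
  by rewrite expr0 mul1r.
rewrite mulr_sumr; apply: eq_big => [y|y /andP[_ /andP[ry _]]].
  by case: (x < y)%O => //=; rewrite /N; lia.
rewrite mulrA -exprS; congr (_ ^+ _ * _); rewrite /N in ry *; lia.
Qed.

End Chains.

(** By [ncmon_sgnw], flag h-numbers on words in a and b become chain counts on words in [lc] and
    [lb]. *)
Lemma ab_index_chain_gf (d : Order.disp_t) (P : finTBPOrderType d)
    (rho : P -> nat) :
  (0 < rho \top%O)%N -> (\bot < \top :> P)%O ->
  (forall x, (rho x < rho \top%O)%N -> (x < \top)%O) ->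
  ab_index rho = chain_gf rho lc lb (rho \top%O).-1 \bot%O.
Proof.
move=> rT bT rho_top; set N := (rho _).-1.
rewrite -chain_gfE //; last by rewrite prednK.
rewrite subnn -ncmon_sgnw -wsum_set /ab_index -/N.
apply: eq_bigr => S _; rewrite -wsum_set /flag_h scaler_suml big_mkcond /=.
apply: eq_bigr => T _; rewrite sgnw_set abmon_ncmon.
case: ifP => _; last by rewrite mul0r mulr0z.
by rewrite -flag_f_chains -scaler_int intz natz.
Qed.

Lemma big_with_bounds (V : nmodType) (P : finType) (Q : pred (with_bounds P)) g :
  ~~ Q Bot -> ~~ Q Top -> \sum_(y | Q y) g y = \sum_(x | Q (Elt x)) g (Elt x) :> V.
Proof.
move=> QB QT; pose e (y : with_bounds P) := if y is Elt x then Some x else None.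
rewrite (reindex_omap (@Elt P) e); first by apply: eq_bigl => x /=; rewrite eqxx andbT.
by case=> [|x|] //= H; rewrite H in QB QT.
Qed.

Section IndexWithBounds.
Variables (d : Order.disp_t) (P : finPOrderType d) (rho : with_bounds P -> nat).
Variable n : nat.
Hypothesis rhoB : rho Bot = 0%N.
Hypothesis rhoT : rho Top = n.+2.
Hypothesis rhoE : forall x, (0 < rho (Elt x) <= n.+1)%N.
Hypothesis rho_lt : forall x y, (x < y)%O -> (rho (Elt x) < rho (Elt y))%N.

(** [F x] is the generating function of the chains above [x]. Ranks increase strictly and lie
    between 1 and [n.+1], so the rank conditions of [chain_gf_closed] hold automatically. *)
Lemma chain_gf_with_bounds (R : pzRingType) (c b : R) : exists F : P -> R,
  (forall x, F x = c ^+ (n.+1 - rho (Elt x)) +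
    \sum_(y | (x < y)%O) c ^+ (rho (Elt y) - rho (Elt x)).-1 * (b * F y)) /\
  chain_gf rho c b n.+1 Bot = c ^+ n.+1 +
    \sum_y c ^+ (rho (Elt y)).-1 * (b * F y).
Proof.
have rhoT' : rho \top%O = n.+2 by [].
exists (fun x => chain_gf rho c b (n.+1 - rho (Elt x)) (Elt x)); split=> [x|].
  rewrite chain_gf_closed rhoT' /=; last by lia.
  congr (_ + _); rewrite big_with_bounds; first last.
  - by rewrite rhoT ltnn andbF.
  - by rewrite rhoB andbF.
  have /andP[rx0 rx1] := rhoE x.
  apply: eq_big => [y|y _]; last by rewrite subKn.
  have /andP[ry0 ry1] := rhoE y; rewrite subKn // ry1 andbT.
  (* Through [<=], the comparison in [with_bounds P] reduces by computation to that in [P]. *)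
  rewrite [(Elt x < _)%O]lt_leAnge.
  rewrite -[(Elt x <= Elt y)%O]/(x <= y)%O -[(Elt y <= Elt x)%O]/(y <= x)%O -lt_leAnge.
  by case: (boolP (x < y)%O) => //= /rho_lt ->.
rewrite chain_gf_closed rhoT' /=; last by lia.
congr (_ + _); rewrite subnn big_with_bounds; first last.
- by rewrite rhoT ltnn andbF.
- by rewrite rhoB andbF.
apply: eq_big => [y|y _]; last by rewrite subn0.
by rewrite rhoE andbT.
Qed.

Lemma ab_index_with_bounds : exists F : P -> abpoly,
  (forall x, F x = lc ^+ (n.+1 - rho (Elt x)) +
    \sum_(y | (x < y)%O) lc ^+ (rho (Elt y) - rho (Elt x)).-1 * (lb * F y)) /\
  ab_index rho = lc ^+ n.+1 + \sum_y lc ^+ (rho (Elt y)).-1 * (lb * F y).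
Proof.
have [F [FE E]] := chain_gf_with_bounds lc lb.
have rhoT' : rho \top%O = n.+2 by [].
exists F; split=> //; rewrite -E ab_index_chain_gf ?rhoT' //.
by case=> [|x|] //; rewrite rhoT ltnn.
Qed.

End IndexWithBounds.

(** * Coproduct segments read letter by letter *)

(* The segments of [v] left after deleting the letters marked by [true] in [w]. *)
Fixpoint segs (w v : seq bool) : seq (seq bool) :=
  match w, v with
  | true :: w', _ :: v' => [::] :: segs w' v'
  | false :: w', x :: v' => (x :: head [::] (segs w' v')) :: behead (segs w' v')
  | _, _ => [:: [::]]
  end.

Lemma segments_head p s v x0 : all (leq p.+1) s -> (p < size v)%N ->
  segments p s v = (nth x0 v p :: head [::] (segments p.+1 s v))
                   :: behead (segments p.+1 s v).
Proof.
case: s => [|i s] /=; first by move=> _ pv; rewrite (drop_nth x0).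
case/andP=> pi _ pv; congr (_ :: _).
by rewrite (drop_nth x0) ?size_take_min ?nth_take //; lia.
Qed.

(** The prefix [u] absorbs the absolute positions used by [segments], so that the induction can run
    on [v]. *)
Lemma segments_mask u v w : size w = size v ->
  segments (size u) (mask w (iota (size u) (size v))) (u ++ v) = segs w v.
Proof.
elim: v u w => [|x v IH] u [|y w] //=; first by rewrite cats0 drop_size.
move=> [sw].
have := IH (rcons u x) w sw; rewrite size_rcons cat_rcons => {}IH.
case: y => /=; first by rewrite IH take_size_cat // drop_size.
rewrite (@segments_head _ _ _ x) ?IH.
- by rewrite nth_cat ltnn subnn.
- apply/allP => i /mem_mask; rewrite mem_iota; lia.
- by rewrite size_cat /=; lia.
Qed.

(** Summing over [k] removes the cardinality condition: a set [J] occurs only for [k = #|J| + 1]. *)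
Lemma sum_phi_ub_k v : \sum_(1 <= k < (size v).+2) phi_ub_k k v =
  wsum (size v) (fun w => ub_term (segs w v)).
Proof.
rewrite big_add1 /= big_mkord /phi_ub_k /=.
have card_lt (J : {set 'I_(size v)}) : (#|J| < (size v).+1)%N.
  by rewrite ltnS (leq_trans (max_card _)) ?card_ord.
transitivity (\sum_(J : {set 'I_(size v)})
    ub_term (segments 0 [seq val i | i <- enum J] v)).
  rewrite [RHS](partition_big (fun J => Ordinal (card_lt J)) predT) //.
rewrite -wsum_set; apply: eq_bigr => J _.
have -> : [seq val i | i <- enum J] =
    mask [seq i \in J | i <- enum 'I_(size v)] (iota 0 (size v)).
  by rewrite -val_enum_ord -map_mask -filter_mask enumT.
by rewrite (@segments_mask [::]) // size_map size_enum_ord.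
Qed.

Lemma double_exprS (R : pzRingType) (c : R) k : 2 * c ^+ k.+1 = c * (2 * c ^+ k).
Proof. by rewrite exprS !mulr_natl mulrnAr. Qed.

(** [eta] restricted to powers of a: the value of the rest of a segment once its a-part is
    reached. *)
Definition alpha (v : seq bool) : abpoly :=
  if v == nseq (size v) false then 2 * lc ^+ size v else 0.

Lemma alpha_cons x v : alpha (x :: v) = if x then 0 else lc * alpha v.
Proof.
rewrite /alpha /= eqseq_cons; case: x => //=; case: ifP => _.
  exact: double_exprS.
by rewrite (mulr0 lc).
Qed.

Lemma kappa_cons x v : kappa (x :: v) = if x then 0 else lc * kappa v.
Proof.
rewrite /kappa /= eqseq_cons; case: x => //=; case: ifP => _.
  exact: exprS.
by rewrite (mulr0 lc).
Qed.

Lemma eta_cons x v : eta (x :: v) = lc * (if x then eta v else alpha v).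
Proof.
rewrite /eta /alpha; case: x => /=.
  rewrite !add0n !add1n eqseq_cons eqxx /=; case: ifP => _.
    exact: double_exprS.
  by rewrite (mulr0 lc).
have sz : (count_mem true v + count_mem false v = size v)%N.
  by rewrite -(count_predC (pred1 true)); congr addn; apply: eq_count => -[].
have E : (false :: v == nseq (count_mem true v) true ++
      nseq (count_mem false v).+1 false) = (v == nseq (size v) false).
  (* If [v] contains the letter b, both comparisons fail. *)
  rewrite -sz; case E: (count_mem true v) => [|k].
    by rewrite eqseq_cons eqxx.
  rewrite eqseq_cons /=; apply/esym/eqP => vE.
  have : true \in v by rewrite -has_pred1 has_count E.
  by rewrite vE inE mem_nseq andbF.
rewrite !add0n !add1n E addnS sz; case: ifP => _.
  exact: double_exprS.
by rewrite (mulr0 lc).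
Qed.

Lemma beta_cons x v : beta (x :: v) = if x then lc * beta v else 0.
Proof.
rewrite /beta /= eqseq_cons; case: x => //=; case: ifP => _.
  exact: exprS.
by rewrite (mulr0 lc).
Qed.

Lemma lambda_ub_cons x v :
  lambda_ub (x :: v) = lc * (if x then lambda_ub v else alpha v).
Proof.
have E (R : pzRingType) (c y z : R) : c * y - 2 * (c * z) = c * (y - 2 * z).
  by rewrite mulrBr !mulr_natl mulrnAr.
rewrite /lambda_ub eta_cons beta_cons; case: x; first exact: E.
by rewrite (mulr0 2) (subr0 (lc * _)).
Qed.

Definition seg_value (s last : bool) (v : seq bool) : abpoly :=
  if s then alpha v else if last then lambda_ub v else eta v.

Lemma seg_value_cons s l x v : seg_value s l (x :: v) =
  if s && x then 0 else lc * seg_value (s || ~~ x) l v.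
Proof.
rewrite /seg_value; case: s => /=; first by rewrite alpha_cons; case: x.
by case: l; rewrite ?lambda_ub_cons ?eta_cons; case: x.
Qed.

Lemma seg_value_nil s : seg_value s false [::] = 2.
Proof. by case: s; rewrite /seg_value /alpha /eta /= expr0 (mulr1 2). Qed.

(** The value of the unread part from within a later segment; that segment is the last one exactly
    when no other follows. *)
Definition ub_open (s : bool) (vs : seq (seq bool)) : abpoly :=
  seg_value s (nilp (behead vs)) (head [::] vs) * ub_tail (behead vs).

Lemma ub_tail_open h t : ub_tail (h :: t) = lb * ub_open false (h :: t).
Proof.
rewrite /ub_open /seg_value; case: t => [|h' t] /=; first by rewrite mulr1.
by rewrite -mulrA.
Qed.

Lemma segsE w v : segs w v = head [::] (segs w v) :: behead (segs w v).
Proof. by case: w v => [|[] w] [|x v]. Qed.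

Lemma wsum_ub_open s v :
  wsum (size v) (fun w => ub_open s (segs w v)) = phiE s v.
Proof.
elim: v s => [|x v IH] s /=.
  rewrite /ub_open /= mulr1 /seg_value; case: s.
    by rewrite /alpha /= expr0 (mulr1 2).
  by rewrite /lambda_ub /eta /beta /= addn0 subrr.
congr (_ + _).
  rewrite -IH -wsum_mulr; case: ifP => [sx|sx].
    (* Zero is written as a product so that [wsum_mulr] can pull out the factor 0. *)
    rewrite (@eq_wsum _ _ _ (fun=> 0 * 0)) ?wsum_mulr ?mul0r // => w _.
    by rewrite /ub_open /= seg_value_cons sx !mul0r.
  apply: eq_wsum => w _.
  by rewrite /ub_open /= seg_value_cons sx -mulrA.
rewrite -IH -wsum_mulr; apply: eq_wsum => w _.
rewrite segsE /ub_open [in LHS]/behead [in LHS]/head ub_tail_open /= seg_value_nil.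
exact: mulrA.
Qed.

Lemma wsum_ub_term v : wsum (size v) (fun w => ub_term (segs w v)) = phiK v.
Proof.
elim: v => [|x v IH] /=; first by rewrite /kappa /= expr0 mulr1.
congr (_ + _).
  case: x.
    rewrite (@eq_wsum _ _ _ (fun=> 0 * 0)) ?wsum_mulr ?mul0r // => w _.
    by rewrite kappa_cons !mul0r.
  rewrite -IH -wsum_mulr; apply: eq_wsum => w _.
  by rewrite kappa_cons -mulrA [in RHS]segsE.
rewrite -wsum_ub_open -wsum_mulr; apply: eq_wsum => w _.
rewrite /kappa /= expr0 mul1r [in LHS]segsE ub_tail_open -segsE.
by [].
Qed.

Lemma ab_lin_ext h h' : (forall w, h w = h' w) -> ab_lin h =1 ab_lin h'.
Proof. by move=> E p; congr (ab_lin _ p); apply/funext. Qed.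

Lemma phi_ub_linK : phi_ub =1 linK.
Proof. by apply: ab_lin_ext => v; rewrite sum_phi_ub_k wsum_ub_term. Qed.

(** * Cells of subarrangements *)

Local Open Scope classical_set_scope.

(** * Strict and weak sign conditions *)

Section SignConditions.
Variable R : realFieldType.
Implicit Types (o : option bool) (t u : R).

Definition ssat o t : bool :=
  match o with None => t == 0 | Some true => 0 < t | Some false => t < 0 end.

(** The closure of [ssat o], and the condition it imposes on recession directions. *)
Definition wsat o t : bool :=
  match o with None => t == 0 | Some true => 0 <= t | Some false => t <= 0 end.

Definition sgno t : option bool :=
  if t == 0 then None else Some (0 < t).

Lemma ssatP o t : reflect (sgno t = o) (ssat o t).
Proof.
rewrite /sgno; apply: (iffP idP) => [|<-].
  by case: o => [[]|] /=; case: (ltgtP t 0) => // ->; rewrite ?ltxx.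
by case: (ltgtP t 0) => //= ->.
Qed.

Lemma ssat_wsat o t : ssat o t -> wsat o t.
Proof. by case: o => [[]|] //= /ltW. Qed.

Lemma wsat0 o : wsat o 0.
Proof. by case: o => [[]|] /=. Qed.

Lemma wsatM o a t : 0 <= a -> wsat o t -> wsat o (a * t).
Proof.
move=> a0; case: o => [[]|] /=; first exact: mulr_ge0.
  by move=> t0; rewrite mulr_ge0_le0.
by move=> /eqP ->; rewrite mulr0.
Qed.

Lemma ssatM o a t : 0 < a -> ssat o t -> ssat o (a * t).
Proof.
move=> a0; case: o => [[]|] /=; first exact: mulr_gt0.
  by move=> t0; rewrite pmulr_rlt0.
by move=> /eqP ->; rewrite mulr0.
Qed.

Lemma wsatD o t u : wsat o t -> wsat o u -> wsat o (t + u).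
Proof.
case: o => [[]|] /=; [exact: addr_ge0 | by move=> *; lra |].
by move=> /eqP -> /eqP ->; rewrite addr0.
Qed.

Lemma ssatD o t u : ssat o t -> wsat o u -> ssat o (t + u).
Proof.
case: o => [[]|] /=; [by move=> *; lra | by move=> *; lra |].
by move=> /eqP -> /eqP ->; rewrite addr0.
Qed.

Lemma wsat_sum_eq0 o t u : wsat o t -> wsat o u -> t + u = 0 -> t = 0.
Proof. by case: o => [[]|] /=; [move=> *; lra | move=> *; lra | move=> /eqP ->]. Qed.

Lemma small_multiple t u : t != 0 ->
  exists2 e, 0 < e & forall a, `|a| <= e -> `|a * u| < `|t|.
Proof.
rewrite -normr_gt0 => t0; have u0 := normr_ge0 u.
have u1 : 0 < 1 + `|u| by lra.
(* Adding 1 keeps the denominator positive and makes the final inequality strict. *)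
exists (`|t| / (1 + `|u|)) => [|a]; first by rewrite divr_gt0.
rewrite ler_pdivlMr // => le_a; rewrite normrM.
have [->|a0] := eqVneq a 0; first by rewrite normr0 mul0r.
by apply: lt_le_trans le_a; rewrite ltr_pM2l ?normr_gt0 // ltrDr.
Qed.

Lemma ssat_open o t u : ssat o t -> (o = None -> u = 0) ->
  exists2 e, 0 < e & forall a, `|a| <= e -> ssat o (t + a * u).
Proof.
case: o => [c|] ot u0; last by exists 1 => // a _; rewrite u0 // mulr0 addr0.
have t0 : t != 0 by move: ot; case: c u0 => _ /=; [move/lt0r_neq0 | move/ltr0_neq0].
have [e e0 eP] := small_multiple u t0; exists e => // a /eP.
case: c ot {u0} => /= ot.
  by rewrite [X in _ < X]gtr0_norm // ltr_norml => /andP[]; lra.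
by rewrite [X in _ < X]ltr0_norm // ltr_norml => /andP[]; lra.
Qed.

Lemma finite_common_eps (I : finType) (P : I -> R -> Prop) :
  (forall i, exists2 e, 0 < e & forall a, `|a| <= e -> P i a) ->
  exists2 e, 0 < e & forall i a, `|a| <= e -> P i a.
Proof.
move=> /(_ _)/cid2-/all_sig2[e e0 eP].
have s0 : 0 <= \sum_i (e i)^-1 by apply: sumr_ge0 => i _; rewrite invr_ge0 ltW.
(* A positive lower bound of all the [e i], valid also for an empty index type. *)
exists (1 + \sum_i (e i)^-1)^-1; first by rewrite invr_gt0; lra.
move=> i a le_a; apply: eP; rewrite (le_trans le_a) // -[leRHS]invrK lef_pV2.
- rewrite (bigD1 i) //= in s0 *; rewrite addrCA lerDl addr_ge0 // sumr_ge0 // => j _.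
  by rewrite invr_ge0 ltW.
- by rewrite posrE; lra.
- by rewrite posrE invr_gt0.
Qed.

End SignConditions.

(** * Spans and ranks of sets of normals *)

Section Arr.
Variables (R : realType) (n m : nat) (N : 'M[R]_(m, n)) (b : 'rV[R]_m).
Local Notation sgn := {ffun 'I_m -> option bool}.
Local Notation hf := (hform N).
Implicit Types (K Z J : {set 'I_m}) (s t : sgn) (x y v w : 'rV[R]_n) (o : option bool).

Lemma hformD i x y : hf i (x + y) = hf i x + hf i y.
Proof. by rewrite /hform mulmxDl mxE. Qed.

Lemma hformZ i a x : hf i (a *: x) = a * hf i x.
Proof. by rewrite /hform -scalemxAl mxE. Qed.

Lemma hformB i x y : hf i (x - y) = hf i x - hf i y.
Proof. by rewrite -scaleN1r hformD hformZ mulN1r. Qed.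

(** Rows outside [Z] are zeroed rather than removed, so that the matrix type does not depend on
    [Z]. *)
Definition subN Z : 'M[R]_(m, n) := \matrix_(i, j) (if i \in Z then N i j else 0).

Definition rk Z := \rank (subN Z).

Lemma subN_mul Z v : (forall i, i \in Z -> hf i v = 0) <-> v *m (subN Z)^T = 0.
Proof.
have E i : (v *m (subN Z)^T) 0 i = if i \in Z then hf i v else 0.
  rewrite /hform !mxE; case: ifP => iZ.
    by apply: eq_bigr => j _; rewrite !mxE iZ.
  by apply: big1 => j _; rewrite !mxE iZ mulr0.
split=> [H|/matrixP H i iZ]; last by have := H 0 i; rewrite E iZ mxE.
by apply/rowP => i; rewrite E mxE; case: ifP => // /H.
Qed.

Lemma row_subN Z i : row i (subN Z) = if i \in Z then row i N else 0.
Proof. by apply/rowP => j; rewrite !mxE; case: ifP; rewrite mxE. Qed.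

Lemma subN_sub Z (p : nat) (A : 'M[R]_(p, n)) :
  (forall i, i \in Z -> (row i N <= A)%MS) -> (subN Z <= A)%MS.
Proof.
move=> H; apply/row_subP => i; rewrite row_subN; case: ifP => [/H//|_].
exact: sub0mx.
Qed.

Lemma subN_mem Z i : i \in Z -> (row i N <= subN Z)%MS.
Proof. by move=> iZ; have := row_sub i (subN Z); rewrite row_subN iZ. Qed.

Lemma subN_mono Z K : Z \subset K -> (subN Z <= subN K)%MS.
Proof. by move=> /fintype.subsetP ZK; apply: subN_sub => i /ZK /subN_mem. Qed.

Lemma span_vanish Z (h : 'I_m) v : (row h N <= subN Z)%MS ->
  (forall i, i \in Z -> hf i v = 0) -> hf h v = 0.
Proof.
move=> /submxP[D DE] /subN_mul v0.
have -> : hf h v = (v *m (row h N)^T) 0 0.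
  by rewrite /hform !mxE; apply: eq_bigr => j _; rewrite !mxE.
by rewrite DE trmx_mul mulmxA v0 mul0mx mxE.
Qed.

(** The columns of the cokernel of [subN Z] are orthogonal to the normals in [Z]; one of them is not
    orthogonal to the normal of [h], and it is rescaled. *)
Lemma notin_span_witness Z (h : 'I_m) : ~~ (row h N <= subN Z)%MS ->
  exists2 v, forall i, i \in Z -> hf i v = 0 & hf h v = 1.
Proof.
rewrite submxE => /matrix0Pn[i0 [j]]; rewrite ord1 => nz {i0}.
pose v := (col j (cokermx (subN Z)))^T.
have hv : hf h v = (row h N *m cokermx (subN Z)) 0 j.
  by rewrite /hform !mxE; apply: eq_bigr => k _; rewrite !mxE mulrC.
have v0 : v *m (subN Z)^T = 0.
  by rewrite -trmx_mul colE mulmxA mulmx_coker mul0mx trmx0.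
exists ((hf h v)^-1 *: v); last by rewrite hformZ mulVf // hv.
by move=> i iZ; rewrite hformZ ((subN_mul Z v).2 v0 i iZ) mulr0.
Qed.

Lemma subN_U1 Z (h : 'I_m) : (subN (h |: Z) :=: subN Z + row h N)%MS.
Proof.
apply/eqmxP/andP; split.
  apply: subN_sub => i /setU1P[->|/subN_mem iZ]; first exact: addsmxSr.
  exact: submx_trans iZ (addsmxSl _ _).
by rewrite addsmx_sub subN_mono ?finset.subsetUr //= subN_mem // setU11.
Qed.

Lemma rk_U1 Z (h : 'I_m) : rk (h |: Z) = (rk Z + ~~ (row h N <= subN Z)%MS)%N.
Proof.
rewrite /rk (subN_U1 Z h); case: (boolP (row h N <= subN Z)%MS) => H /=.
  by rewrite addn0 (addsmx_idPl H).
apply/eqP; rewrite eqn_leq; apply/andP; split.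
  by rewrite (leq_trans (mxrank_adds_leqif _ _)) // leq_add2l rank_leq_row.
rewrite addn1 (ltn_leqif (mxrank_leqif_sup (addsmxSl _ _))).
by rewrite addsmx_sub submx_refl.
Qed.
End Arr.

(** If [u] had the wrong sign, the ray would reach 0 at the parameter [|a| / |u|]; for an equality
    condition the parameter 1 suffices. *)
Lemma ray_wsat (R : realFieldType) o (a u : R) :
  (forall t, 0 <= t -> ssat o (a + t * u)) -> wsat o u.
Proof.
move=> H; have H0 := H 0 (lexx _); rewrite mul0r addr0 in H0.
have [u0|u0|->] := ltgtP u 0; last exact: wsat0.
- have := H (`|a| / - u); rewrite divr_ge0 ?oppr_ge0 ?(ltW u0) // => /(_ isT).
  rewrite -mulrA invrN mulNr mulVf ?lt_eqF // mulrN1.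
  case: o H H0 => [[]|] /= H H0.
  + by rewrite (gtr0_norm H0) subrr ltxx.
  + by rewrite (ltW u0).
  + by move=> _; have := H 1 ler01; rewrite mul1r (eqP H0) add0r.
- have := H (`|a| / u); rewrite divr_ge0 ?(ltW u0) // => /(_ isT).
  rewrite divfK ?gt_eqF //.
  case: o H H0 => [[]|] /= H H0.
  + by rewrite (ltW u0).
  + by rewrite (ltr0_norm H0) addrN ltxx.
  + by move=> _; have := H 1 ler01; rewrite mul1r (eqP H0) add0r.
Qed.

(** * Two functions additive under cutting by a hyperplane *)

Section Valuations.
Variables (R : realType) (n m : nat) (N : 'M[R]_(m, n)) (b : 'rV[R]_m).
Local Notation sgn := {ffun 'I_m -> option bool}.
Local Notation hf := (hform N).
Local Notation subN := (subN N).
Local Notation rk := (rk N).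
Implicit Types (K Z J : {set 'I_m}) (s t : sgn) (x y v w : 'rV[R]_n) (o : option bool).

Definition pcell K s : set 'rV[R]_n :=
  [set x | forall i, i \in K -> ssat (s i) (hf i x - b 0 i)].

(** The recession cone of [pcell K s] when that cell is nonempty; nonemptiness depends on [b] and is
    tested separately. *)
Definition recession K s : set 'rV[R]_n :=
  [set v | forall i, i \in K -> wsat (s i) (hf i v)].

(* The recession cone is a linear space: [pcell K s] is bounded modulo the
   directions orthogonal to all the normals in [K]. *)
Definition linear_recession K s : Prop :=
  forall v, recession K s v -> forall i, i \in K -> hf i v = 0.

Definition zeros K s : {set 'I_m} := [set i in K | s i == None].

Definition update s (h : 'I_m) o : sgn := [ffun i => if i == h then o else s i].

Section Split.
Variables (K : {set 'I_m}) (s : sgn) (h : 'I_m).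
Hypothesis hK : h \notin K.
Let Z := zeros K s.

Let neqK i : i \in K -> (i == h) = false.
Proof. by move=> iK; apply: contraNF hK => /eqP <-. Qed.

Lemma pcell_U1 o x : pcell (h |: K) (update s h o) x <->
  pcell K s x /\ ssat o (hf h x - b 0 h).
Proof.
split=> [H|[H1 H2] i /setU1P[->|iK]]; last 1 first.
- by rewrite ffunE neqK //; apply: H1.
- split=> [i iK|]; last by have := H h (setU11 _ _); rewrite ffunE eqxx.
  by have := H i (setU1r _ iK); rewrite ffunE neqK.
- by rewrite ffunE eqxx.
Qed.

Lemma recession_U1 o v : recession (h |: K) (update s h o) v <->
  recession K s v /\ wsat o (hf h v).
Proof.
split=> [H|[H1 H2] i /setU1P[->|iK]]; last 1 first.
- by rewrite ffunE neqK //; apply: H1.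
- split=> [i iK|]; last by have := H h (setU11 _ _); rewrite ffunE eqxx.
  by have := H i (setU1r _ iK); rewrite ffunE neqK.
- by rewrite ffunE eqxx.
Qed.

Lemma zeros_U1 o : zeros (h |: K) (update s h o) =
  if o is None then h |: Z else Z.
Proof.
apply/setP => i; rewrite /Z /zeros; case: o => [c|]; rewrite !inE ffunE.
  by case: eqP => [->|] //=; rewrite (negbTE hK).
by case: eqP => [->|].
Qed.

Lemma sub_zeros : Z \subset K.
Proof. by apply/fintype.subsetP => i; rewrite inE => /andP[]. Qed.

Lemma pcell_diff x y : pcell K s x -> pcell K s y ->
  forall i, i \in Z -> hf i (x - y) = 0.
Proof.
move=> xC yC i; rewrite inE => /andP[iK /eqP si].
by have := xC i iK; have := yC i iK; rewrite si hformB /= => /eqP + /eqP; lra.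
Qed.

Lemma pcell_ray x v a : pcell K s x -> recession K s v -> 0 <= a ->
  pcell K s (x + a *: v).
Proof.
move=> xC vR a0 i iK; rewrite hformD hformZ addrAC.
by rewrite ssatD ?wsatM //; [apply: xC | apply: vR].
Qed.

Lemma pcell_convex x y a : pcell K s x -> pcell K s y -> 0 < a < 1 ->
  pcell K s (x + a *: (y - x)).
Proof.
move=> xC yC /andP[a0 a1] i iK.
have -> : hf i (x + a *: (y - x)) - b 0 i =
    (1 - a) * (hf i x - b 0 i) + a * (hf i y - b 0 i).
  by rewrite hformD hformZ hformB; ring.
apply: ssatD; first by apply: ssatM; [lra | exact: xC].
by apply: wsatM; [exact: ltW | apply/ssat_wsat; exact: yC].
Qed.

(** The direction [v] preserves the equalities, and the finitely many strict inequalities survive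
    small moves. *)
Lemma pcell_open x v : pcell K s x -> (forall i, i \in Z -> hf i v = 0) ->
  exists2 e, 0 < e & forall a, `|a| <= e -> pcell K s (x + a *: v).
Proof.
move=> xC v0.
have [i|e e0 eP] := @finite_common_eps R 'I_m
  (fun i a => i \in K -> ssat (s i) (hf i (x + a *: v) - b 0 i)).
  case: (boolP (i \in K)) => iK; last by exists 1.
  have [|e e0 eP] := @ssat_open R (s i) (hf i x - b 0 i) (hf i v) (xC i iK).
    by move=> si; apply: v0; rewrite inE iK si.
  by exists e => // a /eP; rewrite hformD hformZ addrAC.
by exists e => // a le_a i; apply: eP.
Qed.

Local Notation part o := (exists x, pcell (h |: K) (update s h o) x).

(** If the normal of [h] is in the span of those in [Z], its form is constant on the cell. Otherwise
    either the hyperplane meets the cell and crosses it, or by convexity the cell lies strictly on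
    one side. *)
Lemma split_parts : (exists x, pcell K s x) ->
  (exists2 o0, forall o, part o <-> o = o0 & o0 = None -> (row h N <= subN Z)%MS)
  \/ (~~ (row h N <= subN Z)%MS /\ forall o, part o).
Proof.
move=> [x xC].
have ptI o y : pcell K s y -> ssat o (hf h y - b 0 h) -> part o.
  by move=> yC oy; exists y; apply/pcell_U1.
case: (boolP (row h N <= subN Z)%MS) => hZ; [left|].
  exists (sgno (hf h x - b 0 h)) => // o; split=> [[y /pcell_U1[yC /ssatP <-]]|->].
    have := span_vanish hZ (pcell_diff xC yC); rewrite hformB => /eqP.
    by rewrite subr_eq0 => /eqP ->.
  by apply: ptI xC _; apply/ssatP.
have [v v0 hv] := notin_span_witness hZ.
(* From a point on the hyperplane, small moves along [v] in both directions reach both sides within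
   the cell. *)
have openP y : pcell K s y -> hf h y - b 0 h = 0 -> forall o, part o.
  move=> yC hy o; have [e e0 eP] := pcell_open yC v0.
  case: o => [[]|]; last by apply: ptI yC _; rewrite /= hy.
    apply: ptI (eP e _) _; first by rewrite gtr0_norm.
    by rewrite hformD hformZ hv /= mulr1 addrAC hy add0r.
  apply: ptI (eP (- e) _) _; first by rewrite normrN gtr0_norm.
  by rewrite hformD hformZ hv /= mulr1 addrAC hy add0r oppr_lt0.
have [[y /pcell_U1[yC /eqP hy]]|p0] := pselect (part None).
  by right; split=> //; apply: openP yC hy.
left; case E: (sgno (hf h x - b 0 h)) => [c|]; last first.
  by case: p0; apply: ptI xC _; apply/ssatP.
exists (Some c) => // o; split=> [[y /pcell_U1[yC oy]]|->]; last first.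
  by apply: ptI xC _; apply/ssatP.
case: o oy => [c'|] oy; last by case: p0; apply: ptI yC oy.
congr Some; apply/eqP; apply: contra_notT p0 => cc'.
move/ssatP: E => ox.
set p := hf h x - b 0 h in ox; set q := hf h y - b 0 h in oy.
(* [p / (p - q)] is the parameter at which the segment from [x] to [y] meets the hyperplane. *)
have pq : p != q /\ 0 < p / (p - q) < 1.
  have [[p0 q0]|[p0 q0]] : (0 < p /\ q < 0) \/ (p < 0 /\ 0 < q).
  - by case: c c' ox oy cc' => [] [] //=; [left|right].
  - have pq : 0 < p - q by lra.
    by split; [lra|rewrite divr_gt0 //= ltr_pdivrMr //; lra].
  - have pq : 0 < q - p by lra.
    split; first lra.
    have -> : p / (p - q) = - p / (q - p) by rewrite -[in RHS]opprB invrN mulrNN.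
    by apply/andP; split; [rewrite divr_gt0 //; lra | rewrite ltr_pdivrMr //; lra].
case: pq => pq le01; apply: ptI (pcell_convex xC yC le01) _ => /=.
rewrite hformD hformZ hformB.
have -> : hf h y - hf h x = q - p by rewrite /p /q; ring.
rewrite addrAC -/p; have pq' : p - q != 0 by rewrite subr_eq0.
by rewrite -[q - p]opprB mulrN divfK // subrr.
Qed.

Local Notation lin o := (linear_recession (h |: K) (update s h o)).

Lemma lin_U1 o : (row h N <= subN K)%MS ->
  lin o <-> (forall v, recession K s v -> wsat o (hf h v) ->
             forall i, i \in K -> hf i v = 0).
Proof.
move=> hs; split=> [L v vR vo i iK|L v /recession_U1[vR vo]].
  by apply: (L v) (setU1r _ iK); apply/recession_U1.
have v0 := L v vR vo => i /setU1P[->|]; last exact: v0.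
exact: span_vanish hs v0.
Qed.

(** The whole cell, with all its rays, lies in the part [o], so by [ray_wsat] its recession
    directions satisfy the condition at [h]. *)
Lemma lin_single o : (row h N <= subN K)%MS ->
  (exists x, pcell K s x) -> (forall o', part o' <-> o' = o) ->
  lin o <-> linear_recession K s.
Proof.
move=> hs [x xC] po; rewrite (lin_U1 o hs).
split=> L v vR; last by move=> _; apply: L.
apply: L => //; apply: (@ray_wsat _ _ (hf h x - b 0 h)) => a a0.
have yC := pcell_ray xC vR a0.
apply/ssatP; apply/po; exists (x + a *: v); apply/pcell_U1; split=> //.
by apply/ssatP; rewrite hformD hformZ addrAC.
Qed.

(** These equivalences yield inclusion-exclusion for the indicators of linearity: both sides minus
    the slice give the whole cell. *)
Lemma lin_all : (row h N <= subN K)%MS ->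
  [/\ lin (Some true) \/ lin (Some false) <-> lin None &
      lin (Some true) /\ lin (Some false) <-> linear_recession K s].
Proof.
move=> hs; split; last first.
  rewrite !(lin_U1 _ hs); split=> [[L1 L2] v vR|L]; last by split=> v vR _; apply: L.
  by have [v0|v0] := leP 0 (hf h v); [apply: L1 | apply: L2 => //=; exact: ltW].
split.
  rewrite !(lin_U1 _ hs).
  by move=> [] L v vR /= /eqP v0; apply: L => //=; rewrite v0.
move=> L0; have [L1|nL1] := pselect (lin (Some true)); first by left.
right; rewrite (lin_U1 _ hs) => w wR /= hw.
have {}L0 := (lin_U1 None hs).1 L0.
have [hw0|hw0] := eqVneq (hf h w) 0; first by apply: L0 => //=; rewrite hw0.
have {hw0}hw : hf h w < 0 by rewrite lt_neqAle hw0.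
case: nL1; rewrite (lin_U1 _ hs) => v vR /= hv.
have [hv0|hv0] := eqVneq (hf h v) 0; first by apply: L0 => //=; rewrite hv0.
have {hv0}hv : 0 < hf h v by rewrite lt_neqAle eq_sym hv0.
(* A positive combination of v and w has value 0 at h, so it vanishes on K;
   as v and w satisfy the same weak inequalities, so does v. *)
suff v0 i : i \in K -> hf i v = 0.
  by have := span_vanish hs v0; move: hv => /[swap] ->; rewrite ltxx.
move=> iK; pose u := - hf h w *: v + hf h v *: w.
have uE j : hf j u = - hf h w * hf j v + hf h v * hf j w.
  by rewrite hformD !hformZ.
have wv j : j \in K -> wsat (s j) (- hf h w * hf j v).
  by move=> jK; apply: wsatM; [lra | exact: vR].
have ww j : j \in K -> wsat (s j) (hf h v * hf j w).
  by move=> jK; apply: wsatM; [lra | exact: wR].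
have : hf i u = 0.
  apply: L0 => // [j jK|]; first by rewrite uE; apply: wsatD; [exact: wv|exact: ww].
  by rewrite uE /=; apply/eqP; ring.
rewrite uE => /(wsat_sum_eq0 (wv _ iK) (ww _ iK)) /eqP.
by rewrite mulf_eq0 oppr_eq0 lt_eqF //= => /eqP.
Qed.

(** Moving along [u] changes only the value at [h]: a multiple of [u] is a non-linear recession
    direction of each open side, while the slice is the cell modulo [u]. *)
Lemma lin_free u : (forall i, i \in K -> hf i u = 0) -> hf h u = 1 ->
  [/\ forall c, ~ lin (Some c), lin None <-> linear_recession K s &
      (exists x, pcell K s x) -> forall o, part o].
Proof.
move=> u0 hu; split=> [c L||[x xC] o].
- have uR : recession (h |: K) (update s h (Some c)) ((if c then 1 else -1) *: u).
    apply/recession_U1; split=> [i iK|]; rewrite hformZ.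
      by rewrite u0 // mulr0 wsat0.
    rewrite hu.
    by case: {L} c => /=; rewrite mulr1 ?ler01 ?lerN10.
  have := L _ uR h (setU11 _ _); rewrite hformZ hu mulr1 => /eqP.
  by case: {L uR} c; rewrite ?oppr_eq0 oner_eq0.
- split=> L v.
    (* Projection along [u] onto the directions of the hyperplane [h], with the same values on
       [K]. *)
    move=> vR i iK; pose v' := v - hf h v *: u.
    have vv' j : j \in K -> hf j v' = hf j v.
      by move=> jK; rewrite hformB hformZ u0 // mulr0 subr0.
    rewrite -vv' //; apply: (L v') (setU1r _ iK); apply/recession_U1.
    split=> [j jK|]; first by rewrite vv' //; apply: vR.
    by rewrite hformB hformZ hu mulr1 subrr /= eqxx.
  move=> /recession_U1[vR /eqP v0] i /setU1P[->//|iK]; exact: L.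
- pose t : R := match o with None => 0 | Some true => 1 | Some false => -1 end.
  exists (x + (t - (hf h x - b 0 h)) *: u); apply/pcell_U1; split=> [i iK|].
    by rewrite hformD hformZ u0 // mulr0 addr0; apply: xC.
  rewrite hformD hformZ hu mulr1 addrAC addrC subrK.
  by rewrite /t; case: o {t} => [[]|] /=; rewrite ?ltr01 ?ltrN10.
Qed.

End Split.

(* The sign of [valB] is that of the dimension of the cell modulo the lineality
   space of the subarrangement [K]. *)
Definition valT K s : int :=
  if `[< exists x, pcell K s x >] then (-1) ^+ rk (zeros K s) else 0.

Definition valB K s : int :=
  if `[< exists x, pcell K s x >] && `[< linear_recession K s >]
  then (-1) ^+ (rk K + rk (zeros K s)) else 0.

Lemma big_option_bool (V : nmodType) (g : option bool -> V) :
  \sum_o g o = g None + g (Some true) + g (Some false).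
Proof.
rewrite (bigD1 None) //= (bigD1 (Some true)) //= (bigD1 (Some false)) //=.
by rewrite big1 ?addr0 ?addrA // => -[[]|].
Qed.

(** A crossed cell gives two parts with its own sign and a slice with the opposite sign; an
    uncrossed cell gives a single part of the same sign. *)
Lemma valT_split K s (h : 'I_m) : h \notin K ->
  valT K s = \sum_o valT (h |: K) (update s h o).
Proof.
move=> hK; rewrite {1}/valT; case: asboolP => [ne|nne]; last first.
  rewrite big1 // => o _; rewrite /valT; case: asboolP => // -[x /(pcell_U1 _ hK)[xC _]].
  by case: nne; exists x.
have valE o : valT (h |: K) (update s h o) =
    if `[< exists x, pcell (h |: K) (update s h o) x >]
    then (if o is None then (-1) ^+ (~~ (row h N <= subN (zeros K s))%MS) else 1)
      * (-1) ^+ rk (zeros K s) else 0.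
  rewrite /valT zeros_U1 //; case: ifP => // _; case: o => [c|]; first by rewrite mul1r.
  by rewrite rk_U1 exprD mulrC.
rewrite (eq_bigr _ (fun o _ => valE o)).
case: (split_parts hK ne) => [[p0 po hZ]|[hZ po]]; last first.
  rewrite big_option_bool !(asboolT (po _)) hZ expr1 !mul1r mulN1r; lia.
rewrite (bigD1 p0) //= (asboolT ((po p0).2 erefl)) big1 => [|o no]; last first.
  by case: asboolP => // /po oo; rewrite oo eqxx in no.
by case: p0 {po} hZ => [c|/(_ erefl) ->]; rewrite mul1r addr0.
Qed.

(** If the normal of [h] is outside the span of [K], only the slice can contribute, and its two
    ranks both grow by 1, which preserves the sign. Otherwise [lin_all] or [lin_single] applies. *)
Lemma valB_split K s (h : 'I_m) : h \notin K ->
  valB K s = \sum_o valB (h |: K) (update s h o).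
Proof.
move=> hK; rewrite {1}/valB; case: (asboolP (exists x, pcell K s x)) => /= [ne|nne]; last first.
  rewrite big1 // => o _; rewrite /valB; case: asboolP => //= -[x /(pcell_U1 _ hK)[xC _]].
  by case: nne; exists x.
set e : int := (-1) ^+ (rk K + rk (zeros K s)).
case: (boolP (row h N <= subN K)%MS) => hs; last first.
  have [u u0 hu] := notin_span_witness hs.
  have [linS linN po] := lin_free s hK u0 hu.
  have hZ : ~~ (row h N <= subN (zeros K s))%MS.
    by apply: contra hs => /submx_trans; apply; rewrite subN_mono ?sub_zeros.
  rewrite big_option_bool /valB !(asboolT (po ne _)) !(asboolF (linS _)) /= !addr0.
  rewrite (asbool_equiv_eq linN) zeros_U1 // !rk_U1 hs hZ.
  by case: ifP => // _; rewrite !addn1 addnS addSn !exprS mulrA mulrNN !mul1r.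
have valE o : valB (h |: K) (update s h o) =
    if `[< exists x, pcell (h |: K) (update s h o) x >]
       && `[< linear_recession (h |: K) (update s h o) >]
    then (if o is None then (-1) ^+ (~~ (row h N <= subN (zeros K s))%MS) else 1) * e
    else 0.
  rewrite /valB zeros_U1 // rk_U1 hs addn0.
  case: ifP => // _; case: o => [c|]; first by rewrite mul1r.
  by rewrite rk_U1 addnA exprD mulrC.
rewrite (eq_bigr _ (fun o _ => valE o)).
case: (split_parts hK ne) => [[p0 po hZ]|[hZ po]]; last first.
  have [l0 l1] := lin_all s hK hs.
  rewrite big_option_bool !(asboolT (po _)) hZ expr1 !mul1r mulN1r /=.
  rewrite -(asbool_equiv_eq l0) -(asbool_equiv_eq l1) asbool_or asbool_and.
  move: `[< linear_recession _ (update s h (Some true)) >].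
  move: `[< linear_recession _ (update s h (Some false)) >].
  by case=> -[] /=; rewrite ?addr0 ?addNr ?add0r.
rewrite (bigD1 p0) //= (asboolT ((po p0).2 erefl)) big1 => [|o no]; last first.
  by case: asboolP => //= /po oo; rewrite oo eqxx in no.
rewrite (asbool_equiv_eq (lin_single hK hs ne po)) addr0 /=; case: ifP => // _.
by case: p0 {po} hZ => [c|/(_ erefl) ->]; rewrite mul1r.
Qed.

(** The missing hyperplanes are added one at a time, by induction on their number. *)
Lemma sum_extensions (V : nmodType) (val : {set 'I_m} -> sgn -> V) :
  (forall K s (h : 'I_m), h \notin K ->
     val K s = \sum_o val (h |: K) (update s h o)) ->
  forall K s, val K s = \sum_(t : sgn | [forall i in K, t i == s i]) val [set: 'I_m]%SET t.
Proof.
move=> split_val K; have [k] := ubnP #|~: K|; elim: k K => // k IH K leK s.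
have [KT|] := eqVneq K [set: 'I_m]%SET.
  rewrite KT (big_pred1 s) // => t.
  apply/forall_inP/eqP => [st|-> //].
  by apply/ffunP => i; apply/eqP; apply: st.
rewrite -finset.subTset => /subsetPn[h _ hK].
rewrite (split_val _ _ h) // [RHS](partition_big (fun t => t h) predT) //=.
apply: eq_bigr => o _; rewrite IH; last first.
  move: leK (cardsC (h |: K)); rewrite -(cardsC K) cardsU1 hK.
  move: #|K| #|~: K| #|~: (h |: K)| => p q r; lia.
apply: eq_bigl => t; apply/forall_inP/andP => [H|[/forall_inP H /eqP th] i].
  split; last by have /eqP := H h (setU11 _ _); rewrite ffunE eqxx => ->.
  apply/forall_inP => i iK; have ih : i != h by apply: contraNneq hK => <-.
  by have := H i (setU1r _ iK); rewrite ffunE (negbTE ih).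
rewrite ffunE; have [->|ih] := eqVneq i h; first by rewrite th.
by rewrite !inE (negbTE ih); apply: H.
Qed.

End Valuations.

(** * Dimension and boundedness of cells *)

Section Cells.
Variables (R : realType) (n m : nat) (N : 'M[R]_(m, n)) (b : 'rV[R]_m).
Local Notation sgn := {ffun 'I_m -> option bool}.
Local Notation hf := (hform N).
Local Notation subN := (subN N).
Local Notation rk := (rk N).
Local Notation allI := [set: 'I_m]%SET.
Local Notation pcell := (pcell N b).
Local Notation linear_recession := (linear_recession N).
Local Notation zeros := (@zeros m).
Implicit Types (K Z J : {set 'I_m}) (s t : sgn) (x y v w : 'rV[R]_n) (o : option bool).

Lemma side_ssat i o x : side N b i o x <-> ssat o (hf i x - b 0 i).
Proof.
case: o => [[]|] /=; rewrite ?subr_gt0 ?subr_lt0 //.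
by rewrite subr_eq0; split=> [->|/eqP].
Qed.

Lemma cellE s : cell N b s = pcell allI s.
Proof.
apply/seteqP; split=> x H i; last by move=> _; apply/side_ssat/H.
by move=> _; apply/side_ssat/H.
Qed.

Lemma flatE J : flat N b J = pcell J [ffun=> None].
Proof.
apply/seteqP; split=> x H i /= iJ.
  by rewrite ffunE; apply/(side_ssat i None)/H.
by apply/(side_ssat i None); have := H i iJ; rewrite ffunE.
Qed.

Lemma zerosN J : zeros J [ffun=> None] = J.
Proof. by apply/setP => i; rewrite inE ffunE andbT. Qed.

(** Differences of points of the cell lie in the kernel of the normals in [zeros K s]; conversely, a
    basis of this kernel, scaled down enough, can be added to a point of the cell. *)
Lemma affdim_pcell K s : pcell K s !=set0 ->
  affdim (pcell K s) = (n - rk (zeros K s))%N.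
Proof.
move=> [x xC]; apply/eqP; rewrite eqn_leq; apply/andP; split.
  apply/bigmax_leqP => k /asboolP[p [V [pC Vfree pV]]].
  have V0 : V *m (subN (zeros K s))^T = 0.
    apply/row_matrixP => i; rewrite row_mul row0; apply/subN_mul => j jZ.
    by have := pcell_diff (pV i) pC jZ; rewrite addrAC subrr add0r.
  have := mulmx0_rank_max V0; rewrite mxrank_tr (eqP Vfree) -/(rk _); lia.
have [V Vfree V0] : exists2 V : 'M[R]_(n - rk (zeros K s), n), row_free V &
    V *m (subN (zeros K s))^T = 0.
  rewrite /rk -mxrank_tr -mxrank_ker; exists (row_base (kermx (subN (zeros K s))^T)).
    exact: row_base_free.
  by apply/sub_kermxP; rewrite eq_row_base.
have lt : (n - rk (zeros K s) < n.+1)%N by rewrite ltnS leq_subr.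
have [i|e e0 eP] := @finite_common_eps R 'I_(n - rk (zeros K s))
    (fun i a => pcell K s (x + a *: row i V)).
  apply: pcell_open xC _; apply/subN_mul.
  by rewrite -row_mul V0 row0.
apply: (@leq_bigmax_cond _ _ _ (Ordinal lt)); apply/asboolP.
exists x, (e *: V); split=> // [|i].
  by rewrite /row_free mxrank_scale_nz // gt_eqF.
have -> : row i (e *: V) = e *: row i V by apply/rowP => j; rewrite !mxE.
by apply: eP; rewrite gtr0_norm.
Qed.

Lemma bounded_setP (A : set 'rV[R]_n) :
  bounded_set A <-> exists M, forall x, A x -> `|x| <= M.
Proof.
split=> [/pinfty_ex_gt0[M _ AM]|[M AM]]; first by exists M.
exists M; split=> [|k Mk x /AM xM]; first exact: num_real.
exact: le_trans xM (ltW Mk).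
Qed.

(** A continuous, positively homogeneous penalty that vanishes exactly when [wsat o u] holds. *)
Definition violation o (u : R) : R :=
  `|u| - match o with None => 0 | Some true => u | Some false => - u end.

Lemma violation_ge0 o u : 0 <= violation o u.
Proof.
rewrite /violation; case: o => [[]|]; rewrite ?subr0 // subr_ge0 ?ler_norm //.
by rewrite -normrN ler_norm.
Qed.

Lemma violation_eq0 o u : violation o u = 0 -> wsat o u.
Proof.
rewrite /violation; case: o => [[]|] /= /eqP; rewrite ?subr0 ?normr_eq0 // subr_eq0.
  by move=> /eqP <-.
by rewrite -oppr_ge0 => /eqP <-.
Qed.

Lemma violationZ o a u : 0 <= a -> violation o (a * u) = a * violation o u.
Proof.
move=> a0; rewrite /violation normrM (ger0_norm a0).
by case: o => [[]|]; ring.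
Qed.

Lemma violation_le o u c : ssat o (u - c) -> violation o u <= 2 * `|c|.
Proof.
rewrite /violation; case: o => [[]|] /=.
- by case: (ger0P u); case: (ger0P c); lra.
- by case: (ger0P u); case: (ger0P c); lra.
- by rewrite subr_eq0 => /eqP ->; have := normr_ge0 c; lra.
Qed.

Hypothesis ess : essential N.

Lemma essential_eq0 v : (forall i, hf i v = 0) -> v = 0.
Proof.
move=> v0; have : v *m N^T = 0 by apply/rowP => i; rewrite [LHS]v0 mxE.
move=> vN; have /row_fullP[B BN] := ess.
apply: trmx_inj; rewrite trmx0 -[v^T]mul1mx -BN -mulmxA -[N]trmxK -trmx_mul vN.
by rewrite trmx0 mulmx0.
Qed.

(** A nonzero recession direction gives an unbounded ray. Conversely the total violation [g] is
    bounded on the cell, homogeneous, and by compactness has a positive minimum on the unit sphere,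
    which bounds the norm. *)
Lemma bounded_cell s : pcell allI s !=set0 ->
  bounded_set (pcell allI s) <-> linear_recession allI s.
Proof.
move=> [x xC]; rewrite bounded_setP; split=> [[M CM] v vR|L].
  have [->|v0] := eqVneq v 0.
    by move=> i _; rewrite -(scale0r (0 : 'rV_n)) hformZ mul0r.
  have nv : 0 < `|v| by rewrite normr_gt0.
  have M0 : 0 <= M by rewrite (le_trans _ (CM _ xC)).
  (* Chosen so that [a *: v] has norm [M + |x| + 1], too large for [x + a *: v] to stay within
     [M]. *)
  pose a := (M + `|x| + 1) / `|v|.
  have a0 : 0 <= a by rewrite divr_ge0 // !addr_ge0.
  have := CM _ (pcell_ray xC vR a0).
  have : `|a *: v| <= `|x + a *: v| + `|x|.
    rewrite -[in leLHS](addKr x (a *: v)) addrC; exact: ler_normB.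
  by rewrite normrZ (ger0_norm a0) /a divfK ?gt_eqF //; lra.
pose g (v : 'rV[R]_n) := \sum_i violation (s i) (hf i v).
have g_cont : continuous g.
  move=> v; apply: continuous_big => [|i _ {}v]; first exact: add_continuous.
  have hc := @hform_continuous R n m N i.
  apply: (@continuousB _ _ _ (fun v => `|hf i v|)).
    by apply: continuous_comp; [exact: hc | exact: norm_continuous].
  case: (s i) => [[]|]; [exact: hc | by apply: continuousN; exact: hc |].
  exact: cst_continuous.
pose S := [set v : 'rV[R]_n | `|v| = 1].
have g_hom a v : 0 <= a -> g (a *: v) = a * g v.
  by move=> a0; rewrite /g mulr_sumr; apply: eq_bigr => i _; rewrite hformZ violationZ.
have gC y : pcell allI s y -> g y <= \sum_i 2 * `|b 0 i|.
  by move=> yC; apply: ler_sum => i _; apply: violation_le; apply: yC.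
have unitS v : v != 0 -> S (`|v|^-1 *: v).
  move=> v0; rewrite /S /= normrZ ger0_norm ?invr_ge0 // mulVf ?normr_eq0 //.
(* The unit sphere is empty when every vector is 0. *)
have [S0|/nonemptyPn S0] := pselect (S !=set0); last first.
  exists 0 => y _; have [->|/unitS] := eqVneq y 0; first by rewrite normr0.
  by rewrite S0.
have Sc : compact S.
  apply: bounded_closed_compact.
    by apply/bounded_setP; exists 1 => y ->.
  apply: (@closed_comp _ _ (fun v : 'rV[R]_n => `|v|) [set 1]).
    by move=> y _; exact: norm_continuous.
  exact: closed_eq.
have [v0 /set_mem v0S v0min] := EVT_min_rV S0 Sc (continuous_subspaceT g_cont).
have gv0 : 0 < g v0.
  rewrite lt_neqAle sumr_ge0 ?andbT => [|i _]; last exact: violation_ge0.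
  apply/eqP => /esym /eqP; rewrite psumr_eq0 => [|i _]; last exact: violation_ge0.
  move=> /allP H0; have : v0 = 0.
    apply: essential_eq0 => i; apply: L => // j _; apply: violation_eq0.
    by apply/eqP; apply: (implyP (H0 j _)) => //; rewrite mem_index_enum.
  by move: v0S => /[swap] ->; rewrite /S /= normr0 => /eqP; rewrite eq_sym oner_eq0.
exists ((\sum_i 2 * `|b 0 i|) / g v0) => y yC.
rewrite ler_pdivlMr //; apply: le_trans (gC _ yC).
have [->|y0] := eqVneq y 0.
  by rewrite normr0 mul0r sumr_ge0 // => i _; exact: violation_ge0.
have := v0min _ (mem_set (unitS _ y0)).
by rewrite g_hom ?invr_ge0 // ler_pdivlMl ?normr_gt0.
Qed.

End Cells.

(** * Faces, flats and Euler relations *)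

Lemma big_codom (V : nmodType) (I J : finType) (f : J -> I) (P : pred I) (g : I -> V) :
  injective f ->
  \sum_(j | P (f j)) g (f j) = \sum_(i | P i && [exists j, f j == i]) g i.
Proof.
move=> finj; rewrite (reindex_omap f (fun i => [pick j | f j == i])).
  apply: eq_bigl => j; case: pickP => [k /eqP /finj ->|/(_ j)]; last by rewrite eqxx.
  rewrite eqxx andbT; have -> : [exists k, f k == f j] by apply/existsP; exists j.
  by rewrite andbT.
move=> i /andP[_ /existsP[j /eqP <-]].
by case: pickP => [k /eqP /finj ->|/(_ j)] //=; rewrite eqxx.
Qed.

Section Posets.
Variables (R : realType) (n m : nat) (N : 'M[R]_(m, n)) (b : 'rV[R]_m).
Local Notation sgn := {ffun 'I_m -> option bool}.
Local Notation hf := (hform N).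
Local Notation subN := (subN N).
Local Notation rk := (rk N).
Local Notation allI := [set: 'I_m]%SET.
Local Notation pcell := (pcell N b).
Local Notation zeros := (@zeros m).
Local Notation faces := (faces N b).
Local Notation flats := (flats N b).
Local Notation ufaces := (unbounded_faces N b).
Implicit Types (K Z J : {set 'I_m}) (s t : sgn) (x y v w : 'rV[R]_n).
Implicit Types (F G : faces) (X Y : flats) (U : ufaces).

Definition fsgn F : sgn := s2val (cid2 (face_signP F)).

Lemma fsgnE F : ssval F = pcell allI (fsgn F).
Proof. by rewrite /fsgn -cellE; case: cid2. Qed.

Lemma fsgn_neq0 F : pcell allI (fsgn F) !=set0.
Proof. by rewrite /fsgn; case: cid2 => /= s _ [x xs]; exists x; rewrite -cellE. Qed.

Lemma pcell_sgn K s t x : pcell K s x -> pcell K t x -> forall i, i \in K -> s i = t i.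
Proof. by move=> xs xt i iK; move/ssatP: (xs i iK) => <-; apply/ssatP/xt. Qed.

Lemma fsgn_inj : injective fsgn.
Proof. by move=> F G E; apply: val_inj => /=; rewrite !fsgnE E. Qed.

Lemma fsgn_exists s : pcell allI s !=set0 -> exists F, fsgn F = s.
Proof.
move=> s0.
have sP : cell N b s \in [seq F <- [seq cell N b s | s : {ffun 'I_m -> option bool}]
          | `[< F !=set0 >]].
  rewrite mem_filter; apply/andP; split; first by apply/asboolP; rewrite cellE.
  by apply/mapP; exists s => //; rewrite mem_enum.
exists (SeqSub sP); case: s0 => x xs; apply/ffunP => i.
have xF : pcell allI (fsgn (SeqSub sP)) x by rewrite -fsgnE /= cellE.
exact: (pcell_sgn xF xs (finset.in_setT _)).
Qed.

(** One direction treats each hyperplane separately. For the other, the points [x + a *: (y - x)]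
    with small positive [a] lie in [G] and tend to [x]. *)
Lemma face_leE F G : (F <= G)%O <->
  forall i, fsgn F i = None \/ fsgn F i = fsgn G i.
Proof.
split=> [/asboolP FG i|H].
  have [x xF] := fsgn_neq0 F; rewrite !fsgnE in FG.
  apply: (@side_closure R n m N b i _ _ x); last by apply/side_ssat; apply: xF.
  apply: closureS (FG x xF) => y yG; apply/side_ssat; exact: yG.
apply/asboolP; rewrite !fsgnE => x xF; have [y yG] := fsgn_neq0 G.
have cv : (fun a : R => x + a *: (y - x)) @ (0 : R)^'+ --> x.
  rewrite -[X in _ --> X]addr0 -(scale0r (y - x)).
  apply: cvgD; first exact: cvg_cst.
  by apply: cvgZr_tmp; apply: cvg_within.
move=> B Bx; near ((0 : R)^'+) => a; exists (x + a *: (y - x)); split=> [i iK|]; last first.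
  by near: a; exact: cv.
have -> : hf i (x + a *: (y - x)) - b 0 i =
    a * (hf i y - b 0 i) + (1 - a) * (hf i x - b 0 i).
  by rewrite hformD hformZ hformB; ring.
have a0 : 0 < a by near: a; exact: nbhs_right_gt.
have a1 : a < 1 by near: a; exact: nbhs_right_lt.
apply: ssatD; first by apply: ssatM => //; apply: yG.
apply: wsatM; first lra.
have := xF i iK; have [->|->] := H i; last exact: ssat_wsat.
by move=> /= /eqP ->; exact: wsat0.
Unshelve. all: by end_near.
Qed.

Definition usgn U : sgn := fsgn (val U).

Lemma usgn_inj : injective usgn.
Proof. by move=> U U' /fsgn_inj /val_inj. Qed.

Lemma flat_mem J : flat N b J !=set0 ->
  flat N b J \in [seq X <- [seq flat N b J | J : {set 'I_m}] | `[< X !=set0 >]].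
Proof.
move=> J0; rewrite mem_filter; apply/andP; split; first exact/asboolP.
by apply/mapP; exists J => //; rewrite mem_enum.
Qed.

Lemma flat_setP X : exists2 J, ssval X = flat N b J & flat N b J !=set0.
Proof.
case: X => X /= Xin; move: (Xin); rewrite mem_filter => /andP[/asboolP X0].
by case/mapP => J _ E; exists J => //; rewrite -E.
Qed.

(** Some set of hyperplanes cutting out [X], not necessarily the largest. *)
Definition flat_set X : {set 'I_m} := s2val (cid2 (flat_setP X)).

Lemma flat_setE X : ssval X = flat N b (flat_set X).
Proof. by rewrite /flat_set; case: cid2. Qed.

Lemma flat_set_neq0 X : flat N b (flat_set X) !=set0.
Proof. by rewrite /flat_set; case: cid2. Qed.

Lemma flat_mem_pt J x : flat N b J x <-> forall i, i \in J -> hf i x = b 0 i.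
Proof. by split=> H i iJ; apply: H. Qed.

Lemma pcell_zeros s x : pcell allI s x -> flat N b (zeros allI s) x.
Proof.
move=> xs; apply/flat_mem_pt => i; rewrite inE => /andP[iI /eqP si].
by have := xs i iI; rewrite si /= subr_eq0 => /eqP.
Qed.

Lemma pcell_flat J s x : pcell allI s x ->
  flat N b J x <-> J \subset zeros allI s.
Proof.
move=> xs; split=> [/flat_mem_pt xJ|/fintype.subsetP JZ].
  apply/fintype.subsetP => i iJ; rewrite !inE /=; apply/eqP.
  have := xs i (finset.in_setT _); rewrite xJ // subrr => /ssatP <-.
  by rewrite /sgno eqxx.
by apply/flat_mem_pt => i /JZ iZ; apply: (flat_mem_pt _ _).1 (pcell_zeros xs) i iZ.
Qed.

Lemma span_neq0 U : flat N b (zeros allI (usgn U)) !=set0.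
Proof. by have [x xU] := fsgn_neq0 (val U); exists x; apply: pcell_zeros. Qed.

(** The affine span of a face is the intersection of the hyperplanes containing it. *)
Definition uspan U : flats := SeqSub (flat_mem (span_neq0 U)).

Lemma le_uspan X U : (X <= uspan U)%O = (flat_set X \subset zeros allI (usgn U)).
Proof.
have [x xU] := fsgn_neq0 (val U).
apply/asboolP/idP; rewrite /= flat_setE.
  by move=> H; apply/(pcell_flat _ xU)/H/pcell_zeros.
move=> /fintype.subsetP H y /flat_mem_pt yU; apply/flat_mem_pt => i /H; exact: yU.
Qed.

Lemma affdim_flat X : affdim (ssval X) = (n - rk (flat_set X))%N.
Proof.
rewrite flat_setE flatE affdim_pcell ?zerosN // -flatE; exact: flat_set_neq0.
Qed.

Lemma affdim_face F : affdim (ssval F) = (n - rk (zeros allI (fsgn F)))%N.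
Proof. by rewrite fsgnE affdim_pcell //; exact: fsgn_neq0. Qed.

Lemma affdim_uspan U : affdim (ssval (val U)) = affdim (ssval (uspan U)).
Proof.
rewrite affdim_face /= flatE affdim_pcell ?zerosN // -flatE; exact: span_neq0.
Qed.

(** If the ranks for [X] and [J] agreed, every form in [J] would be constant on [X] with the value
    it takes at a point of [Y], forcing [X = Y]. *)
Lemma affdim_flat_lt X Y : X != Y -> (X <= Y)%O ->
  (affdim (ssval Y) < affdim (ssval X))%N.
Proof.
move=> XY /asboolP YX; pose J := flat_set X :|: flat_set Y.
have YE : flat N b (flat_set Y) = flat N b J.
  apply/seteqP; split=> x /flat_mem_pt xY; apply/flat_mem_pt => i; last first.
    by move=> iY; apply: xY; rewrite inE iY orbT.
  rewrite inE => /orP[|]; last exact: xY.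
  have : flat N b (flat_set X) x.
    by rewrite -flat_setE; apply: YX; rewrite flat_setE; apply/flat_mem_pt.
  by move=> /flat_mem_pt; apply.
have [y yY] := flat_set_neq0 Y.
have dY : affdim (ssval Y) = (n - rk J)%N.
  by rewrite flat_setE YE flatE affdim_pcell ?zerosN // -flatE -YE; exists y.
rewrite dY affdim_flat.
have lt : (rk (flat_set X) < rk J)%N.
  rewrite (ltn_leqif (mxrank_leqif_sup (subN_mono N (finset.subsetUl _ _)))).
  apply: contra XY => JX; apply/eqP/val_inj => /=; apply/seteqP; split=> // x.
  rewrite [ssval X]flat_setE [ssval Y]flat_setE YE in YX * => xX.
  have yX := YX y; rewrite -YE in yX.
  apply/flat_mem_pt => i iJ; apply/eqP; rewrite -subr_eq0.
  have <- : hf i y = b 0 i by move: yY; rewrite YE => /flat_mem_pt; apply.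
  rewrite -hformB; apply/eqP; apply: (@span_vanish _ _ _ _ (flat_set X)).
    exact: submx_trans (subN_mem N iJ) JX.
  move=> j jX; rewrite hformB.
  move/flat_mem_pt: xX => -> //; move/flat_mem_pt: (yX yY) => -> //; exact: subrr.
(* Since subtraction truncates at 0, strictness also needs [rk J <= n]. *)
have := rank_leq_col (subN J); rewrite -/(rk J); lia.
Qed.
End Posets.

(** * Euler relations over unbounded faces *)

Section Euler.
Variables (R : realType) (n m : nat) (N : 'M[R]_(m, n)) (b : 'rV[R]_m).
Local Notation sgn := {ffun 'I_m -> option bool}.
Local Notation rk := (rk N).
Local Notation allI := [set: 'I_m]%SET.
Local Notation pcell := (pcell N b).
Local Notation linear_recession := (linear_recession N).
Local Notation zeros := (@zeros m).
Local Notation faces := (faces N b).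
Local Notation flats := (flats N b).
Local Notation ufaces := (unbounded_faces N b).
Implicit Types (K Z J : {set 'I_m}) (s t : sgn) (x y v w : 'rV[R]_n).
Implicit Types (F G : faces) (X Y : flats) (U : ufaces).

Hypothesis ess : essential N.
Local Notation usgn := (@usgn R n m N b).
Local Notation uspan := (@uspan R n m N b).

Lemma usgn_codom s : [exists U, usgn U == s] =
  `[< exists x, pcell allI s x >] && ~~ `[< linear_recession allI s >].
Proof.
apply/existsP/andP => [[U /eqP <-]|[/asboolP s0 /asboolPn nL]].
  split; first exact/asboolP/fsgn_neq0.
  apply/asboolPn => L; case: (asboolP _ (valP U)); rewrite fsgnE.
  by apply/bounded_cell => //; exact: fsgn_neq0.
have [F Fs] := fsgn_exists s0.
have FU : `[< ~ bounded_set (ssval F) >].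
  by apply/asboolP; rewrite fsgnE Fs; move=> /bounded_cell => /(_ ess s0).
by exists (exist _ F FU); rewrite /usgn /= Fs.
Qed.

Lemma rk_le Z : (rk Z <= n)%N.
Proof. exact: rank_leq_col. Qed.

Lemma rk_all : rk allI = n.
Proof.
have -> : rk allI = \rank N; last exact/eqP.
by congr mxrank; apply/matrixP => i j; rewrite mxE finset.in_setT.
Qed.

Lemma sgnr_subn (k : nat) : (k <= n)%N -> (-1) ^+ (n - k) = (-1) ^+ (n + k) :> int.
Proof.
move=> kn; rewrite -[in RHS](subnK kn) -addnA addnn exprD.
by rewrite -[(-1) ^+ _.*2]signr_odd odd_double mulr1.
Qed.

(** Passes from faces to all sign vectors, where the valuations live; [valT] discards the empty
    cells. *)
Lemma sum_usgn (P : pred sgn) :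
  \sum_(U | P (usgn U)) (-1) ^+ affdim (ssval (val U)) =
  \sum_(s | P s) (if `[< linear_recession allI s >] then 0
     else (-1) ^+ n * valT N b allI s) :> int.
Proof.
rewrite (eq_bigr (fun U => (-1) ^+ (n + rk (zeros allI (usgn U))))) => [|U _]; last first.
  by rewrite affdim_face sgnr_subn ?rk_le.
rewrite (@big_codom _ _ _ usgn P (fun s => (-1) ^+ (n + rk (zeros allI s)))); last first.
  exact: usgn_inj.
rewrite big_mkcondr; apply: eq_bigr => s _; rewrite usgn_codom /valT exprD.
by case: asboolP => _; case: asboolP => _ //=; rewrite mulr0.
Qed.

(** All faces minus the bounded ones: the sums of [valT] and [valB] collapse to their values on the
    flat itself, whose two equal ranks make [valB] equal to 1. *)
Lemma euler_unbounded X :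
  \sum_(U | (X <= uspan U)%O) (-1) ^+ affdim (ssval (val U)) =
  (-1) ^+ affdim (ssval X) - 1 :> int.
Proof.
pose J := flat_set X; have J0 : exists x, pcell J [ffun=> None] x.
  by have [x xJ] := flat_set_neq0 X; exists x; rewrite -flatE.
under eq_bigl do rewrite le_uspan.
rewrite (@sum_usgn (fun s => J \subset zeros allI s)).
rewrite (eq_bigr (fun s => (-1) ^+ n * valT N b allI s - valB N b allI s)) => [|s _]; last first.
  rewrite /valB /valT rk_all exprD.
  by case: asboolP => _; case: asboolP => _ /=; rewrite ?mulr0 ?subrr ?subr0.
rewrite sumrB -mulr_sumr.
have PE : (fun s => J \subset zeros allI s) =1
    (fun s => [forall i in J, s i == [ffun=> None] i]).
  move=> s; apply/fintype.subsetP/forall_inP => H i /H; rewrite !inE ffunE //.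
rewrite !(eq_bigl _ _ PE).
rewrite -(sum_extensions (@valT_split R n m N b)) -(sum_extensions (@valB_split R n m N b)).
rewrite /valT /valB (asboolT J0) zerosN asboolT; last first.
  by move=> v vR i iJ; have := vR i iJ; rewrite ffunE /= => /eqP.
rewrite affdim_flat sgnr_subn ?rk_le // [(-1) ^+ (n + _)]exprD; congr (_ - _).
by rewrite addnn -signr_odd odd_double.
Qed.

Lemma ufaces_leE U V : (U <= V)%O <->
  forall i, usgn U i = None \/ usgn U i = usgn V i.
Proof. by rewrite -(face_leE (val U) (val V)) leEsub. Qed.

Lemma linear_recession_mono s t : (forall i, s i = None \/ s i = t i) ->
  linear_recession allI t -> linear_recession allI s.
Proof.
move=> st L v vR; apply: L => i iI; have := vR i iI.
by case: (st i) => -> //= /eqP ->; exact: wsat0.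
Qed.

(** The faces concerned are the nonempty cells with the signs of [U] on [K]. All are unbounded
    because [U] is, so [valT] alone gives the sum. *)
Lemma euler_above X U : (X <= uspan U)%O ->
  \sum_(V | (X <= uspan V)%O && (U <= V)%O) (-1) ^+ affdim (ssval (val V)) =
  (-1) ^+ affdim (ssval X) :> int.
Proof.
rewrite le_uspan => /fintype.subsetP JU; set J := flat_set X in JU.
(* The signs of [V] are forced where [U] is off the hyperplane and on the hyperplanes defining
   [X]. *)
pose s0 := usgn U; pose K := J :|: [set i | s0 i != None].
have nL : ~ linear_recession allI s0.
  have : [exists V, usgn V == s0] by apply/existsP; exists U.
  by rewrite usgn_codom => /andP[_ /asboolPn].
rewrite (eq_bigl (fun V => [forall i in K, usgn V i == s0 i])) => [|V]; last first.
  rewrite le_uspan -/J; apply/andP/forall_inP => [[/fintype.subsetP JV /ufaces_leE UV] i|H].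
    rewrite !inE => /orP[iJ|]; last by case: (UV i) => ->; rewrite ?eqxx.
    by have := JV i iJ; have := JU i iJ; rewrite !inE /= => /eqP -> /eqP ->.
  split; first apply/fintype.subsetP => i iJ.
    have iK : i \in K by rewrite inE iJ.
    have /eqP E := H i iK.
    by have := JU i iJ; rewrite !inE /= E.
  apply/ufaces_leE => i; have [->|i0] := eqVneq (usgn U i) None; first by left.
  by right; apply/esym/eqP; apply: H; rewrite !inE i0 orbT.
rewrite (@sum_usgn (fun s => [forall i in K, s i == s0 i])).
rewrite (eq_bigr (fun s => (-1) ^+ n * valT N b allI s)) => [|s /forall_inP H]; last first.
  case: asboolP => // L; case: nL; apply: linear_recession_mono L => i.
  have [->|i0] := eqVneq (s0 i) None; first by left.
  by right; apply/esym/eqP; apply: H; rewrite !inE i0 orbT.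
rewrite -mulr_sumr -(sum_extensions (@valT_split R n m N b)) /valT asboolT; last first.
  have [x xU] := fsgn_neq0 (val U); exists x => i _; apply: xU; exact: finset.in_setT.
rewrite affdim_flat sgnr_subn ?rk_le // exprD; congr (_ * (-1) ^+ rk _).
(* The hyperplanes in [K] that contain [U] are exactly those in [J]. *)
apply/setP => i; rewrite !inE; apply/andP/idP => [[/orP[//|/negbTE ->//]]|iJ].
by have := JU i iJ; rewrite iJ !inE /=.
Qed.

Lemma uspan_le U V : (U <= V)%O -> (uspan V <= uspan U)%O.
Proof.
move=> /ufaces_leE UV; apply/asboolP => x /= /flat_mem_pt xU.
apply/flat_mem_pt => i; rewrite inE => /andP[iI /eqP iV].
by apply: xU; rewrite inE iI /=; case: (UV i) => ->; rewrite ?iV.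
Qed.

(** With equal spans, every hyperplane containing [U] contains [V], so the two sign vectors
    agree. *)
Lemma uspan_neq U V : U != V -> (U <= V)%O -> uspan V != uspan U.
Proof.
move=> UV /ufaces_leE leUV; apply: contra UV => /eqP /(congr1 (@ssval _ _)) /= E.
apply/eqP/usgn_inj/ffunP => i; have [Ui|//] := leUV i.
have [x xV] := fsgn_neq0 (val V).
have := pcell_zeros xV; rewrite E => /(pcell_flat _ xV) /fintype.subsetP /(_ i).
by rewrite !inE Ui => /(_ isT) /eqP ->.
Qed.

End Euler.

Theorem theorem4p4 (R : realType) (n m : nat) (N : 'M[R]_(m, n)) (b : 'rV[R]_m)
  (normal_neq0 : forall i, row i N != 0)
  (ess : essential N) (nc : noncentral N b) :
  ab_index (@unbounded_rank R n m N b)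
  = phi_ub (ab_index (@intersection_rank R n m N b)).
Proof.
rewrite phi_ub_linK.
pose dA (X : flats N b) := affdim (ssval X).
(* In the dual order, [U <= V] means that [V] lies in the closure of [U], as the transfer
   requires. *)
pose dB (U : (unbounded_faces N b)^d%type) := affdim (ssval (val U)).
have dA_le X : (dA X <= n)%N by rewrite /dA affdim_flat leq_subr.
have dB_le U : (dB U <= n)%N by rewrite /dB affdim_face leq_subr.
have dB_sp U : dB U = dA (uspan U) by exact: affdim_uspan.
have ltA X Y : (X < Y)%O -> (dA Y < dA X)%N.
  by rewrite lt_neqAle => /andP[]; exact: affdim_flat_lt.
have leB_sp (U V : (unbounded_faces N b)^d%type) : (U <= V)%O -> (uspan U <= uspan V)%O.
  by move=> UV; apply: uspan_le; rewrite -leEdual.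
have leB_neq (U V : (unbounded_faces N b)^d%type) :
    U != V -> (U <= V)%O -> uspan U != uspan V.
  by rewrite eq_sym => UV leUV; apply: uspan_neq => //; rewrite -leEdual.
have ltB (U V : (unbounded_faces N b)^d%type) : (U < V)%O -> (dB V < dB U)%N.
  rewrite lt_neqAle => /andP[UV leUV]; rewrite !dB_sp; apply: affdim_flat_lt.
    exact: leB_neq.
  exact: leB_sp.
(* Rank is [n + 1] minus dimension, so the rank differences in the chain recursion become dimension
   differences. *)
have [FA [FAE FA0]] : exists F : flats N b -> abpoly,
  (forall X, F X = lc ^+ dA X +
    \sum_(Y | (X != Y) && (X <= Y)%O) lc ^+ (dA X - dA Y).-1 * (lb * F Y)) /\
  ab_index (@intersection_rank R n m N b) = lc ^+ n.+1 +
    \sum_X lc ^+ (n - dA X) * (lb * F X).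
  have [||X|X Y|F [FE F0]] := @ab_index_with_bounds _ (flats N b) (@intersection_rank R n m N b) n.
  - by [].
  - by rewrite /= addn2.
  - by rewrite /= -/(dA X); have := dA_le X; lia.
  - by move=> /ltA; rewrite /= -/(dA X) -/(dA Y); have := dA_le X; lia.
  exists F; split=> [X|].
    rewrite [LHS]FE; congr (lc ^+ _ + _).
      by rewrite /= -/(dA X); have := dA_le X; lia.
    apply: eq_big => [Y|Y XY]; first by rewrite lt_neqAle.
    congr (lc ^+ _.-1 * _); rewrite /= -/(dA X) -/(dA Y).
    by have := dA_le X; have := ltA _ _ XY; lia.
  rewrite F0; congr (_ + _); apply: eq_bigr => X _; congr (lc ^+ _ * _).
  by rewrite /= -/(dA X) addn1.
have [FB [FBE FB0]] : exists F : (unbounded_faces N b)^d%type -> abpoly,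
  (forall U, F U = lc ^+ dB U +
    \sum_(V | (U != V) && (U <= V)%O) lc ^+ (dB U - dB V).-1 * (lb * F V)) /\
  ab_index (@unbounded_rank R n m N b) = lc ^+ n.+1 +
    \sum_U lc ^+ (n - dB U) * (lb * F U).
  have [||U|U V|F [FE F0]] :=
      @ab_index_with_bounds _ ((unbounded_faces N b)^d%type) (@unbounded_rank R n m N b) n.
  - by [].
  - by rewrite /= addn2.
  - by rewrite /= -/(dB U); have := dB_le U; lia.
  - by move=> /ltB; rewrite /= -/(dB U) -/(dB V); have := dB_le U; lia.
  exists F; split=> [U|].
    rewrite [LHS]FE; congr (lc ^+ _ + _).
      by rewrite /= -/(dB U); have := dB_le U; lia.
    apply: eq_big => [V|V UV]; first by rewrite lt_neqAle.
    congr (lc ^+ _.-1 * _); rewrite /= -/(dB U) -/(dB V).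
    by have := dB_le U; have := ltB _ _ UV; lia.
  rewrite F0; congr (_ + _); apply: eq_bigr => U _; congr (lc ^+ _ * _).
  by rewrite /= -/(dB U); have := dB_le U; lia.
pose EB := [the {additive abpoly -> abpoly} of linEB].
pose D := [the {additive abpoly -> abpoly} of linD].
pose K := [the {additive abpoly -> abpoly} of linK].
apply: (@K_bottom _ lc lb EB D K linEB_lc linEB_lb linD_lc linD_lb linK_lc linK_lb
  linEB1 linD1 linK1 n _ _ (@Order.le _ _) (@Order.le _ _) dA dB (@uspan R n m N b) FA FB).
- exact: le_refl.
- exact: le_trans.
- exact: affdim_flat_lt.
- exact: le_refl.
- exact: leB_sp.
- exact: leB_neq.
- exact: dB_sp.
- exact: FAE.
- exact: FBE.
- exact: euler_unbounded.
- exact: euler_above.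
- exact: FA0.
- exact: FB0.
Qed.
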